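(* Assume that conditions A1 and A2 (stated in the context) hold and that the chain $Z$ is Harris recurrent. For $m\ge 1$, $1\le l\le t$ and $n\ge l$ let $\nu^t_{l:n;m}$ denote the random probability vector on $\mathcal Y^m$ given by $\nu^t_{l:n;m}(v)=P(Y_{t:t+m-1}=v\mid X_{l:n})$, $v\in\mathcal Y^m$. (i) For all $l,s\ge 1$, $$\sup_{n\ge t}\ \sup_{m\ge 1}\ \|\nu^t_{l:n;m}-\nu^t_{s:n;m}\|_{\rm TV}\longrightarrow 0\quad\text{as } t\to\infty,\quad\text{a.s.}$$ (ii) If $Z$ is positive Harris, then there exists a constant $\alpha$ with $0<\alpha<1$ such that the following holds: for every $s\ge 1$ there exists a $\sigma(X_{s:\infty})$-measurable random variable $C_s<\infty$ such that for all $t\ge s\ge l\ge 1$ $$\sup_{n\ge t}\ \sup_{m\ge 1}\ \|\nu^t_{l:n;m}-\nu^t_{s:n;m}\|_{\rm TV}\le C_s\,\alpha^{t-s},\quad\text{a.s.}$$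
   Context: Setting. $\mathcal X$ is a Polish space with Borel $\sigma$-field $\mathcal B(\mathcal X)$, $\mathcal Y=\{1,\dots,|\mathcal Y|\}$ is a finite set, $\mathcal Z=\mathcal X\times\mathcal Y$ with $\sigma$-field $\mathcal B(\mathcal Z)=\mathcal B(\mathcal X)\otimes 2^{\mathcal Y}$. $\mu$ is a $\sigma$-finite measure on $\mathcal B(\mathcal X)$ and $c$ is the counting measure on $2^{\mathcal Y}$. $q:\mathcal Z^2\to[0,\infty)$, $(z',z)\mapsto q(z'|z)$, is measurable and for each $z$ the function $z'\mapsto q(z'|z)$ is a probability density with respect to $\mu\times c$. $Z=\{Z_k\}_{k\ge1}=\{(X_k,Y_k)\}_{k\ge1}$ is a homogeneous Markov chain on a probability space $(\Omega,\mathcal F,\mathbf P)$ with transition kernel $P(Z_2\in C\mid Z_1=z)=\int_C q(z'|z)\,(\mu\times c)(dz')$; $Z_1$ has a density with respect to $\mu\times c$ and its law is otherwise arbitrary. ''a.s.'' refers to $\mathbf P$. $P_z$ is the law of the chain started at $Z_1=z$. $a_{l:n}$ denotes $(a_l,\dots,a_n)$, $n\le\infty$. $\|\xi\|_{\rm TV}=\sum_i|\xi(i)|$ for a signed measure $\xi$ on a finite set. Notation. For $n\ge2$, $x_{1:n}\in\mathcal X^n$, $i,j\in\mathcal Y$, $$p_{ij}(x_{1:n})=\sum_{y_{1:n}:\,y_1=i,\,y_n=j}\ \prod_{k=2}^n q(x_k,y_k|x_{k-1},y_{k-1}),\qquad \mathcal Y^+(x_{1:n})=\{(i,j):p_{ij}(x_{1:n})>0\}.$$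 For a set $A$ of vectors of length $r>1$, $A_{(k)}=\{x_k: x_{1:r}\in A\}$ is its $k$-th projection and $A(x_1)=\{x_{2:r}:x_{1:r}\in A\}$ (measures of projections are understood with respect to the completed $\sigma$-field). Chain terminology. $Z$ is $\varphi$-irreducible, for a $\sigma$-finite measure $\varphi$ on $\mathcal B(\mathcal Z)$, if $\varphi(A)>0$ implies $\sum_{k\ge2}P_z(Z_k\in A)>0$ for all $z\in\mathcal Z$; $\psi$ denotes the maximal irreducibility measure (it dominates every irreducibility measure). $Z$ is Harris recurrent if it is $\psi$-irreducible and $\psi(A)>0$ implies $P_z(Z_k\in A\text{ i.o.})=1$ for all $z$; it is positive if its kernel admits an invariant probability measure; positive Harris means positive and Harris recurrent. Conditions (with the same $r$ and $E$). A1: There exist an integer $r>1$ and a measurable set $E\subset\mathcal X^r$ such that $\mathcal Y^+:=\mathcal Y^+(x_{1:r})\ne\emptyset$ is the same for all $x_{1:r}\in E$, and $\mathcal Y^+=\mathcal Y^+_{(1)}\times\mathcal Y^+_{(2)}$. A2: $Z$ is $\psi$-irreducible with $\psi(E_{(1)}\times\mathcal Y^+_{(1)})>0$, and $\mu^{r-1}(E(x_1))>0$ for all $x_1\in E_{(1)}$. *)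

(* Defs.v *)
From HB Require Import structures.
From mathcomp Require Import all_boot all_order all_algebra.
From mathcomp Require Import all_classical all_reals all_analysis.
From mathcomp Require Import measurable_realfun.

Set Implicit Arguments.
Unset Strict Implicit.
Unset Printing Implicit Defensive.

Import Order.TTheory GRing.Theory Num.Theory.
Import numFieldNormedType.Exports.

Local Open Scope classical_set_scope.
Local Open Scope ring_scope.

Definition polish_space (R : realType) (T : topologicalType) : Prop :=
  (exists2 D : set T, countable D & dense D) /\
  exists dist : T -> T -> R,
    [/\ forall x y, 0 <= dist x y,
        forall x y, dist x y = 0 <-> x = y,
        forall x y, dist x y = dist y x,
        forall x y z, dist x z <= dist x y + dist y z &
        (forall (x : T) (A : set T), nbhs x A <->
           exists2 e : R, 0 < e & [set y | dist x y < e] `<=` A) /\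
        (forall u : nat -> T,
           (forall e : R, 0 < e -> exists N : nat,
              forall m n, (N <= m)%N -> (N <= n)%N -> dist (u m) (u n) < e) ->
           exists x : T, u @ \oo --> x)].

Definition borel (T : ptopologicalType) := g_sigma_algebraType (@open T).
HB.instance Definition _ (T : ptopologicalType) := Measurable.on (borel T).

(* 'I_N.+1 stands for {1, ..., |Y|} with |Y| = N.+1; every subset is
   measurable. *)
HB.instance Definition _ (N : nat) := isPointed.Build 'I_N.+1 ord0.
HB.instance Definition _ (N : nat) := @isMeasurable.Build
  default_measure_display 'I_N.+1 discrete_measurable discrete_measurable0
  discrete_measurableC discrete_measurableU.

Section counting_ordinal.
Context (R : realType) (N : nat).

Let counting_ord_finite : fin_num_fun (@counting 'I_N.+1 R).
Proof. by move=> A _; rewrite /counting asboolT//; exact: finite_finset. Qed.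

HB.instance Definition _ := Measure_isFinite.Build _ _ _
  (@counting 'I_N.+1 R) counting_ord_finite.

End counting_ordinal.

(* Generating family of sigma(V_k, k in I). *)
Definition generators (Omega : Type) d (T : measurableType d) (I : set nat)
    (V : nat -> Omega -> T) : set_system Omega :=
  \bigcup_(k in I) preimage_set_system setT (V k) measurable.

(* Measurability with respect to sigma(G). *)
Definition generated_measurable (Omega : pointedType) d (T : measurableType d)
    (G : set_system Omega) (f : Omega -> T) : Prop :=
  measurable_fun setT (f : g_sigma_algebraType G -> T).

Section conditional_probability.
Context d (Omega : measurableType d) (R : realType) (P : probability Omega R).
Local Open Scope ereal_scope.

(* f is a version of P(A | sigma(G)), where G generates the sub-sigma-field. *)
Definition cond_prob (G : set_system Omega) (A : set Omega)
    (f : Omega -> \bar R) : Prop :=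
  [/\ generated_measurable G f,
      P.-integrable setT f &
      forall B, <<s G >> B -> \int[P]_(w in B) f w = P (A `&` B)].

(* nu is a random probability vector whose v-th coordinate is a version of
   P(V = v | sigma(G)). *)
Definition cond_law (S : finType) (G : set_system Omega) (V : Omega -> S)
    (nu : Omega -> S -> R) : Prop :=
  (forall w, (forall v, (0 <= nu w v)%R) /\ (\sum_v nu w v = 1)%R) /\
  forall v, cond_prob G (V @^-1` [set v]) (fun w => (nu w v)%:E).

End conditional_probability.

Definition tv_norm (R : realType) (S : finType) (xi : S -> R) : R :=
  \sum_i `|xi i|.

Section chain.
Context d (X : measurableType d) (N : nat) (R : realType).
Variable mu : {sigma_finite_measure set X -> \bar R}.
Local Notation Y := 'I_N.+1.
Local Notation Z := (X * Y)%type.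
(* q z' z stands for q(z' | z). *)
Variable q : Z -> Z -> R.
Local Open Scope ereal_scope.

(* mu x c, with c the counting measure. *)
Definition ref_measure : {measure set Z -> \bar R} :=
  mu \x (@counting Y R : {sigma_finite_measure set Y -> \bar R}).

Definition transition_density : Prop :=
  [/\ forall z' z, (0 <= q z' z)%R,
      measurable_fun setT (fun u : Z * Z => q u.1 u.2) &
      forall z, \int[ref_measure]_z' (q z' z)%:E = 1].

Definition trans_kernel (z : Z) (C : set Z) : \bar R :=
  \int[ref_measure]_(z' in C) (q z' z)%:E.

(* Time starts at 1: the value at index 0 is irrelevant. *)
Definition markov_chain d' (Omega : measurableType d') (P : probability Omega R)
    (Zs : nat -> Omega -> Z) : Prop :=
  (forall k, (1 <= k)%N -> measurable_fun setT (Zs k)) /\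
  forall k (C : set Z), (1 <= k)%N -> measurable C ->
    cond_prob P (generators [set i | (1 <= i <= k)%N] Zs) (Zs k.+1 @^-1` C)
      (fun w => trans_kernel (Zs k w) C).

Definition has_density (nu : set Z -> \bar R) : Prop :=
  exists f : Z -> R, [/\ forall z, (0 <= f z)%R, measurable_fun setT f &
    forall C, measurable C -> nu C = \int[ref_measure]_(z in C) (f z)%:E].

Definition path_space : Type :=
  g_sigma_algebraType (generators setT (fun k (w : nat -> Z) => w k)).
HB.instance Definition _ := Measurable.on path_space.

(* The k-th state of a path, k >= 1; paths are stored from index 0. *)
Definition coord (k : nat) (w : path_space) : Z := w k.-1.

(* Q is the law of the chain started at z. *)
Definition law_from (z : Z) (Q : probability path_space R) : Prop :=
  markov_chain Q coord /\
  forall C, measurable C -> Q (coord 1 @^-1` C) = \d_z C.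

Variable Pz : Z -> probability path_space R.

Definition irreducible (phi : set Z -> \bar R) : Prop :=
  forall A, measurable A -> 0 < phi A ->
    forall z, 0 < \sum_(2 <= k <oo) Pz z (coord k @^-1` A).

Definition max_irreducible (psi : {sigma_finite_measure set Z -> \bar R}) : Prop :=
  irreducible psi /\
  forall phi : {sigma_finite_measure set Z -> \bar R},
    irreducible phi -> phi `<< psi.

Definition harris_recurrent (psi : {sigma_finite_measure set Z -> \bar R}) : Prop :=
  max_irreducible psi /\
  forall A, measurable A -> 0 < psi A ->
    forall z, Pz z (lim_sup_set (fun k => coord k @^-1` A)) = 1.

Definition positive_chain : Prop :=
  exists pi : probability Z R, forall C, measurable C ->
    \int[pi]_z trans_kernel z C = pi C.

Definition path_weight n (x : n.-tuple X) (i j : Y) : R :=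
  (\sum_(y : n.-tuple Y | (nth point y 0 == i) && (nth point y n.-1 == j))
    \prod_(1 <= k < n)
      q (nth point x k, nth point y k) (nth point x k.-1, nth point y k.-1))%R.

Definition Yplus n (x : n.-tuple X) : {set Y * Y} :=
  [set ij | (0 < path_weight x ij.1 ij.2)%R]%SET.

Definition first_proj r (E : set (r.-tuple X)) : set X :=
  [set x1 | exists w : r.-1.-tuple X, exists2 x, E x & tval x = x1 :: w].

Definition section r (E : set (r.-tuple X)) (x1 : X) : set (r.-1.-tuple X) :=
  [set w | exists2 x, E x & tval x = x1 :: w].

(* The product measure mu^n on X^n, by iterated integration. *)
Fixpoint power_measure n : set (n.-tuple X) -> \bar R :=
  match n with
  | 0 => fun A => (\1_A [tuple])%:E
  | n'.+1 => fun A =>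
      \int[mu]_x power_measure [set w : n'.-tuple X | A [tuple of x :: w]]
  end.

Definition condA1 r (E : set (r.-tuple X)) (Yp : {set Y * Y}) : Prop :=
  [/\ (1 < r)%N, measurable E, Yp != finset.set0,
      forall x, E x -> Yplus x = Yp &
      Yp = finset.setX [set ij.1 | ij in Yp]%SET [set ij.2 | ij in Yp]%SET].

(* first_proj E is analytic, hence in general only measurable with respect to
   the completed sigma-field, on which the completion of psi is given by the
   outer measure psi^*. *)
Definition condA2 (psi : {sigma_finite_measure set Z -> \bar R})
    r (E : set (r.-tuple X)) (Yp : {set Y * Y}) : Prop :=
  [/\ max_irreducible psi,
      0 < (psi^*)%mu (first_proj E `*` [set` [set ij.1 | ij in Yp]%SET]) &
      forall x1, first_proj E x1 -> 0 < power_measure (section E x1)].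

Section smoothing.
Context d' (Omega : measurableType d') (P : probability Omega R).
Variable Zs : nat -> Omega -> Z.

Definition Xs k w := (Zs k w).1.

(* Y_{t:t+m-1} *)
Definition Yblock t m (w : Omega) : m.-tuple Y :=
  [tuple (Zs (t + i) w).2 | i < m].

(* nu t l n m is nu^t_{l:n;m} *)
Definition smoothing_law
    (nu : forall t l n m : nat, Omega -> m.-tuple Y -> R) : Prop :=
  forall t l n m, (1 <= m)%N -> (1 <= l <= t)%N -> (l <= n)%N ->
    cond_law P (generators [set k | (l <= k <= n)%N] Xs) (Yblock t m)
      (nu t l n m).

Definition sup_tv (nu : forall t l n m : nat, Omega -> m.-tuple Y -> R)
    (t l s : nat) (w : Omega) : \bar R :=
  ereal_sup [set e | exists n m, [/\ (t <= n)%N, (1 <= m)%N &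
    e = (tv_norm (fun v => nu t l n m w v - nu t s n m w v)%R)%:E]].

End smoothing.
End chain.

(* Main.v *)
Require Import Defs.
From HB Require Import structures.
From mathcomp Require Import all_boot all_order all_algebra.
From mathcomp Require Import all_classical all_reals all_analysis.
From mathcomp Require Import measurable_realfun.
From mathcomp Require Import finmap ring lra zify.
Import Order.TTheory GRing.Theory Num.Theory.
Import numFieldNormedType.Exports.
Set Implicit Arguments.
Unset Strict Implicit.
Unset Printing Implicit Defensive.
Local Open Scope classical_set_scope.
Local Open Scope ring_scope.

(** Write V for the hidden block Y_{t:t+m-1}. Fix s <= t <= n and a set S of values
    of V, and let b i be the likelihood of the observations X_{s+1:n} when the
    chain starts from (X_s, i) at time s, and g i that of these observations
    together with the event that V is in S.

    Forgetting as bracketing. If c * b i <= g i for every hidden state i, then the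
    conditional probability that V is in S given X_{l:n} is at least c, for all
    l <= s: the observations before s only act through the law of Y_s
    ([smoothing_prob_lower_bound]). Applied to S and to its complement, this puts
    the smoothing probabilities of S given X_{l:n} and given X_{s:n} in the same
    interval [lo, hi] as soon as lo * b <= g <= hi * b, a relation that depends
    on X_{s:n} only. It remains to find brackets with a small hi - lo.

    Contraction. At time t the bracket [0, 1] is available, and (b, g) at time s is
    obtained from (b, g) at time t by applying the nonnegative matrices
    q (X_{k+1}, j | X_k, i). These preserve brackets. Over a good block, a window of
    length r in E on which the positive weights p_ij lie in [e, 1/e], the product
    of the matrices has all its positive entries, comparable to each other, on the
    rectangle Y^+; by Doeblin's argument the bracket then shrinks by the factor
    1 - e^2 ([bracketed_doeblin]). Accounting for overlaps with theta < 1 such that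
    1 - e^2 <= theta^r, the total variation distance is at most
    2 * theta^(C - r), where C is the number of good blocks that start between s
    and t ([bracketed_backward], [ae_sup_tv_le]).

    Infinitely many good blocks. For some e, a good block starts with probability at
    least delta > 0 from every state of a set D of positive psi measure
    ([accessible_blocks]). By Harris recurrence D is visited infinitely often, so
    that conditionally on any event of finite horizon infinitely many good blocks
    occur with probability at least delta, hence almost surely by Levy's zero-one
    law ([harris_io]). This proves the first part.

    Linearly many good blocks. If there is an invariant probability, the maximal
    ergodic inequality shows that for M large the inequality n <= M * C_n holds for
    all n with positive probability under the stationary law, where C_n counts the
    good blocks starting before n. Existence of K with n <= M * C_n + K for all n is
    shift invariant, hence by recurrence has probability 1 from every initial
    state or 0 from every initial state, and the latter is excluded
    ([linear_growth]). The second part follows with theta <= alpha^M.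

    The arguments on the chain are carried out for the laws P_z on path space,
    starting from the first-step decomposition [Pz_step]; [trajectory_law]
    transfers them to the given chain. *)

(** * Integrals of nonnegative functions *)
Section ge0_measurable_ind.
Context d (T : measurableType d) (R : realType).
Local Open Scope ereal_scope.
Variable Pr : (T -> \bar R) -> Prop.
Hypothesis Pr_indic : forall A, measurable A -> Pr (fun x => (\1_A x)%:E).
Hypothesis Pr_scale : forall (k : R) f, (0 <= k)%R -> (forall x, 0 <= f x) ->
  measurable_fun setT f -> Pr f -> Pr (fun x => k%:E * f x).
Hypothesis Pr_add : forall f g, (forall x, 0 <= f x) -> (forall x, 0 <= g x) ->
  measurable_fun setT f -> measurable_fun setT g ->
  Pr f -> Pr g -> Pr (fun x => f x + g x).
Hypothesis Pr_lim : forall (u : nat -> T -> \bar R) f,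
  (forall n x, 0 <= u n x) -> (forall n, measurable_fun setT (u n)) ->
  (forall x, nondecreasing_seq (u ^~ x)) ->
  (forall x, u n x @[n --> \oo] --> f x) -> (forall n, Pr (u n)) -> Pr f.

Import HBNNSimple.

(** Nonnegative measurable functions are increasing limits of nonnegative
    combinations of indicators. *)
Lemma ge0_measurable_ind f : (forall x, 0 <= f x) -> measurable_fun setT f -> Pr f.
Proof.
move=> f0 mf.
pose u := nnsfun_approx measurableT mf.
apply: (Pr_lim (u := fun n x => (u n x)%:E)).
- by move=> n x; rewrite lee_fin.
- by move=> n; exact/measurable_EFinP.
- by move=> x a b ab; rewrite lee_fin; exact/lefP/nd_nnsfun_approx.
- by move=> x; exact: cvg_nnsfun_approx.
move=> n; move: (u n) => {}u.
pose s : seq R := finmap.enum_fset (fset_set (range u)).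
have -> : (fun x => (u x)%:E) = fun x =>
    \sum_(r <- s) (r%:E * (\1_(u @^-1` [set r]) x)%:E).
  apply/funext => x; rewrite fimfunE fsbig_finite//= -sumEFin.
  by apply: eq_bigr => r _; rewrite EFinM.
have : forall r, r \in s -> (0 <= r)%R.
  move=> r rs; have : (r \in fset_set (range u)) by [].
  by rewrite in_fset_set// => /set_mem[x _ <-].
elim: s => [_|r s ih rs].
  under eq_fun do rewrite big_nil.
  by have := Pr_indic measurable0; congr Pr; apply/funext => x; rewrite indic0.
under eq_fun do rewrite big_cons.
have r0 : (0 <= r)%R by apply: rs; rewrite inE eqxx.
have s0 r' : r' \in s -> (0 <= r')%R by move=> r's; apply: rs; rewrite inE r's orbT.
have m1 (t : R) : measurable_fun setT (fun x => (\1_(u @^-1` [set t]) x)%:E : \bar R).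
  by apply/measurable_EFinP; exact: measurable_indic.
apply: Pr_add => //.
- by move=> x; rewrite mule_ge0 ?lee_fin.
- by move=> x; rewrite big_seq; apply: sume_ge0 => t /s0 ts; rewrite mule_ge0 ?lee_fin.
- exact: measurable_funeM.
- by apply: emeasurable_sum => t; exact: measurable_funeM.
- by apply: Pr_scale => //; exact: Pr_indic.
- exact: ih.
Qed.

End ge0_measurable_ind.

Section finite_counting.
Context (R : realType) (N : nat).
Local Open Scope ereal_scope.

(** The counting measure is the sum of the Dirac measures. *)
Lemma ge0_integral_counting (g : 'I_N.+1 -> \bar R) : (forall y, 0 <= g y) ->
  \int[@counting 'I_N.+1 R]_y g y = \sum_y g y.
Proof.
move=> g0.
have mg : measurable_fun setT g by move=> _ B _.
rewrite (@eq_measure_integral _ _ _ _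
  (msum (fun k : nat => \d_(inord k : 'I_N.+1)) N.+1)); last first.
  move=> A _ _; rewrite /= /msum /counting asboolT; last exact: finite_finset.
  under eq_bigr do rewrite inord_val.
  rewrite (eq_bigr (fun i => ((i \in A)%:R : R)%:E))//.
  rewrite sumEFin -natr_sum; congr (_%:R%:E).
  rewrite (eq_bigr (fun i => if i \in A then 1%N else 0%N)); last first.
    by move=> i _; case: (i \in A).
  rewrite -big_mkcond/= sum1_card cardE; apply: perm_size; apply: uniq_perm.
  - exact: finmap.fset_uniq.
  - exact: enum_uniq.
  - by move=> i; rewrite mem_enum in_fset_set//; exact: finite_finset.
rewrite ge0_integral_measure_sum//.
by apply: eq_bigr => i _; rewrite integral_dirac// diracT mul1e inord_val.
Qed.

End finite_counting.

Lemma ge0_cvg_integral d (T : measurableType d) (R : realType)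
    (m : {measure set T -> \bar R}) (D : set T) (u : nat -> T -> \bar R)
    (f : T -> \bar R) : measurable D ->
  (forall n x, D x -> 0 <= u n x)%E -> (forall n, measurable_fun D (u n)) ->
  (forall x, D x -> nondecreasing_seq (u ^~ x)) ->
  (forall x, D x -> u n x @[n --> \oo] --> f x) ->
  (\int[m]_(x in D) u n x)%E @[n --> \oo] --> (\int[m]_(x in D) f x)%E.
Proof.
move=> mD u0 mu_ ndu uf.
have -> : (\int[m]_(x in D) f x = \int[m]_(x in D) limn (u ^~ x))%E.
  by apply: eq_integral => x /set_mem Dx; apply/esym/cvg_lim => //; exact: uf.
by apply: cvg_monotone_convergence => // x _; exact: ndu.
Qed.
Arguments ge0_cvg_integral {d T R} m {D u f}.

Lemma measure_mono d (T : measurableType d) (R : realType)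
    (m : {measure set T -> \bar R}) (A B : set T) :
  measurable A -> measurable B -> A `<=` B -> (m A <= m B)%E.
Proof. by move=> mA mB AB; apply: le_measure => //; exact: mem_set. Qed.

(** Both sides are additive and continuous along increasing sequences in f, so
    that agreement on indicators suffices. With Dirac measures for k, the lemma
    also turns an integral over D into an integral against an image measure. *)
Lemma ge0_integral_mixture d1 d2 (T : measurableType d1) (S : measurableType d2)
    (R : realType) (m : {measure set T -> \bar R}) (D : set T)
    (k : T -> {measure set S -> \bar R}) (m1 : {measure set S -> \bar R}) f :
  measurable D -> (forall U, measurable U -> measurable_fun setT (k ^~ U)) ->
  (forall U, measurable U -> (\int[m]_(t in D) k t U = m1 U)%E) ->
  (forall x, 0 <= f x)%E -> measurable_fun setT f ->
  (\int[m]_(t in D) \int[k t]_x f x = \int[m1]_x f x)%E.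
Proof.
move=> mD mk km1.
have i0 (h : S -> \bar R) (t : T) : (forall x, 0 <= h x)%E -> D t -> (0 <= \int[k t]_x h x)%E.
  by move=> h0 _; exact: integral_ge0.
have mi (h : S -> \bar R) : (forall x, 0 <= h x)%E -> measurable_fun setT h ->
    measurable_fun D (fun t => \int[k t]_x h x)%E.
  by move=> h0 mh; apply: measurable_funTS; exact: measurable_fun_integral_kernel.
move: f; pose Pr f := (\int[m]_(t in D) \int[k t]_x f x = \int[m1]_x f x)%E.
refine (@ge0_measurable_ind _ _ _ Pr _ _ _ _); rewrite /Pr {Pr}.
- move=> A mA; under [LHS]eq_integral do rewrite integral_indic// setIT.
  by rewrite km1// integral_indic// setIT.
- move=> c f c0 f0 mf ih.
  rewrite (ge0_integralZl_EFin m1 measurableT (fun x _ => f0 x) mf c0) -ih.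
  rewrite -(ge0_integralZl_EFin m mD (fun t => i0 f t f0) (mi _ f0 mf) c0).
  apply: eq_integral => t _.
  exact: (ge0_integralZl_EFin _ measurableT (fun x _ => f0 x) mf c0).
- move=> f g f0 g0 mf mg ihf ihg.
  rewrite (ge0_integralD m1 measurableT (fun x _ => f0 x) mf (fun x _ => g0 x) mg).
  rewrite -ihf -ihg.
  rewrite -(ge0_integralD m mD (fun t => i0 f t f0) (mi _ f0 mf) (fun t => i0 g t g0) (mi _ g0 mg)).
  apply: eq_integral => t _.
  exact: (ge0_integralD _ measurableT (fun x _ => f0 x) mf (fun x _ => g0 x) mg).
- move=> u f u0 mu_ ndu uf ih.
  have cvg1 := ge0_cvg_integral m1 measurableT (fun n x _ => u0 n x) mu_
    (fun x _ => ndu x) (fun x _ => uf x).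
  have cvg2 : (\int[m]_(t in D) \int[k t]_x u n x)%E @[n --> \oo] -->
      (\int[m]_(t in D) \int[k t]_x f x)%E.
    apply: ge0_cvg_integral => //.
    + by move=> n t _; exact: integral_ge0.
    + by move=> n; exact: mi.
    + by move=> t _ a b ab; apply: ge0_le_integral => // x _; exact: ndu.
    + by move=> t _; apply: ge0_cvg_integral.
  apply: (cvg_unique _ cvg2) => //.
  by rewrite (funext ih).
Qed.

Lemma measurable_preimage d1 d2 (T1 : measurableType d1) (T2 : measurableType d2)
  (f : T1 -> T2) A : measurable_fun setT f -> measurable A -> measurable (f @^-1` A).
Proof. by move=> mf mA; rewrite -[X in measurable X]setTI; exact: mf. Qed.

(** * The transition kernel *)
Section kernel.
Context d (X : measurableType d) (N : nat) (R : realType).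
Variable mu : {sigma_finite_measure set X -> \bar R}.
Local Notation Y := 'I_N.+1.
Local Notation Z := (X * Y)%type.
Variable q : Z -> Z -> R.
Hypothesis qd : transition_density mu q.
Local Open Scope ereal_scope.

Let q_ge0 z' z : (0 <= q z' z)%R. Proof. by case: qd. Qed.

Lemma measurable_q d1 (T1 : measurableType d1) (f g : T1 -> Z) :
  measurable_fun setT f -> measurable_fun setT g ->
  measurable_fun setT (fun t => q (f t) (g t)).
Proof.
move=> mf mg; have [_ mq _] := qd.
exact: (measurableT_comp mq (measurable_fun_pair mf mg)).
Qed.

Lemma ge0_integral_ref (f : Z -> \bar R) : (forall z, 0 <= f z) ->
  measurable_fun setT f ->
  \int[ref_measure N mu]_z f z = \int[mu]_x \sum_j f (x, j).
Proof.
move=> f0 mf; rewrite /ref_measure fubini_tonelli1//.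
by apply: eq_integral => x _; rewrite /fubini_F ge0_integral_counting.
Qed.

(** The transition density is an argument so that the measure structure of ker,
    whose construction depends on it, is determined by the term. *)
Definition ker (_ : transition_density mu q) (z : Z) : set Z -> \bar R :=
  trans_kernel mu q z.

Let ker0 z : ker qd z set0 = 0.
Proof. by rewrite /ker /trans_kernel integral_set0. Qed.

Let ker_ge0 z A : 0 <= ker qd z A.
Proof. by apply: integral_ge0 => ? _; rewrite lee_fin. Qed.

Let ker_sigma_additive z : semi_sigma_additive (ker qd z).
Proof.
move=> F mF tF mUF; rewrite /ker /trans_kernel ge0_integral_bigcup//.
- by apply: is_cvg_nneseries => n _ _; apply: integral_ge0 => ? _; rewrite lee_fin.
- by apply/measurable_EFinP; apply: measurable_funTS; exact: measurable_q.
- by move=> *; rewrite lee_fin.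
Qed.

HB.instance Definition _ z := isMeasure.Build _ _ _ (ker qd z)
  (ker0 z) (ker_ge0 z) (@ker_sigma_additive z).

Lemma ker_setT z : ker qd z setT = 1.
Proof. by have [_ _ /(_ z)] := qd. Qed.

Let mqf (f : Z -> \bar R) z : measurable_fun setT f ->
  measurable_fun setT (fun z' => (q z' z)%:E * f z').
Proof.
move=> mf; apply: emeasurable_funM => //; apply/measurable_EFinP.
exact: measurable_q.
Qed.

Lemma integral_ker_ref z (f : Z -> \bar R) : (forall z, 0 <= f z) ->
  measurable_fun setT f ->
  \int[ker qd z]_z' f z' = \int[ref_measure N mu]_z' ((q z' z)%:E * f z').
Proof.
move: f; pose Pr f := \int[ker qd z]_z' f z' = \int[ref_measure N mu]_z' ((q z' z)%:E * f z').
refine (@ge0_measurable_ind _ _ _ Pr _ _ _ _); rewrite /Pr {Pr}.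
- move=> A mA; rewrite integral_indic// setIT.
  rewrite /= /ker /trans_kernel [LHS]integral_mkcond. apply: eq_integral => z' _.
  by rewrite patchE indicE; case: ifPn => _; rewrite ?mule1 ?mule0.
- move=> k {}f k0 f0 mf ih.
  rewrite ge0_integralZl_EFin// ih -ge0_integralZl_EFin//.
  + by apply: eq_integral => z' _; rewrite muleCA.
  + by move=> *; rewrite mule_ge0// lee_fin.
  + exact: mqf.
- move=> {}f g f0 g0 mf mg ihf ihg.
  rewrite ge0_integralD// ihf ihg -ge0_integralD//.
  + by apply: eq_integral => z' _; rewrite ge0_muleDr.
  + by move=> *; rewrite mule_ge0// lee_fin.
  + exact: mqf.
  + by move=> *; rewrite mule_ge0// lee_fin.
  + exact: mqf.
- move=> u {}f u0 mu_ ndu uf ih.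
  have q0 z' : 0 <= (q z' z)%:E by rewrite lee_fin.
  have cvg1 := ge0_cvg_integral (ker qd z) measurableT (fun n x _ => u0 n x)
    mu_ (fun x _ => ndu x) (fun x _ => uf x).
  have cvg2 := ge0_cvg_integral (ref_measure N mu) measurableT
    (fun n x _ => mule_ge0 (q0 x) (u0 n x)) (fun n => mqf z (mu_ n))
    (fun x _ m n mn => lee_wpmul2l (q0 x) (ndu x m n mn))
    (fun x _ => cvgeZl (fin_numE (q x z)%:E) (uf x)).
  apply: (cvg_unique _ cvg1) => //.
  by rewrite (funext ih).
Qed.

(** With the finite sum over hidden states inside, only mu is integrated: the
    measurability in z then comes from Fubini's theorem for mu. *)
Lemma integral_ker z (f : Z -> \bar R) : (forall z, 0 <= f z) ->
  measurable_fun setT f ->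
  \int[ker qd z]_z' f z' = \int[mu]_x \sum_j ((q (x, j) z)%:E * f (x, j)).
Proof.
move=> f0 mf; rewrite integral_ker_ref// ge0_integral_ref//.
- by move=> z'; rewrite mule_ge0// lee_fin.
- exact: mqf.
Qed.

Lemma measurable_ker U : measurable U -> measurable_fun setT (fun z => ker qd z U).
Proof.
move=> mU.
have E z : ker qd z U = fubini_F mu
   (fun u : Z * X => \sum_j ((q (u.2, j) u.1)%:E * (\1_U (u.2, j))%:E)) z.
  rewrite /fubini_F/= -[X in ker qd z X](setIT U) -integral_indic// integral_ker//.
  by apply/measurable_EFinP; exact: measurable_indic.
rewrite (funext E).
apply: measurable_fun_fubini_tonelli_F.
- apply: emeasurable_sum => j; apply: emeasurable_funM; apply/measurable_EFinP.
    apply: measurable_q => //.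
    by apply: measurable_fun_pair => //.
  apply: measurableT_comp (measurable_indic _) _ => //.
  by apply: measurable_fun_pair => //.
- by move=> u; apply: sume_ge0 => j _; rewrite mule_ge0 ?lee_fin.
Qed.

Lemma measurable_integral_ker (f : Z -> \bar R) : (forall z, 0 <= f z) ->
  measurable_fun setT f ->
  measurable_fun setT (fun z => \int[ker qd z]_z' f z').
Proof.
by move=> f0 mf; apply: measurable_fun_integral_kernel => //; exact: measurable_ker.
Qed.

End kernel.

(** * Path space *)
Section paths.
Context d (X : measurableType d) (N : nat).
Local Notation Z := (X * 'I_N.+1)%type.
Local Notation path := (path_space X N).

Definition path_cons (z : Z) (w : path) : path :=
  fun k => if k is k'.+1 then w k' else z.

Definition shift (k : nat) (w : path) : path := fun i => w (k + i)%N.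

Lemma measurable_to_path d1 (T1 : measurableType d1) (f : T1 -> path) :
  (forall k, measurable_fun setT (fun t => f t k)) -> measurable_fun setT f.
Proof.
move=> mf.
apply: (@measurability _ _ _ _ setT f
  (generators setT (fun k (w : nat -> Z) => w k))) => //.
move=> _ [_ [k _ [A mA <-]] <-]; rewrite !setTI.
by have := mf k measurableT A mA; rewrite !setTI.
Qed.

Lemma measurable_path_coord k : measurable_fun setT (fun w : path => w k).
Proof.
move=> _ A mA; rewrite setTI; apply: sub_sigma_algebra.
by exists k => //; exists A => //; rewrite setTI.
Qed.

Lemma measurable_path_cons z : measurable_fun setT (path_cons z).
Proof.
apply: measurable_to_path => -[|k] /=; first exact: measurable_cst.
exact: measurable_path_coord.
Qed.

Lemma measurable_shift k : measurable_fun setT (shift k).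
Proof. by apply: measurable_to_path => i; exact: measurable_path_coord. Qed.

Definition cylinder n (C : nat -> set Z) : set path :=
  [set w | forall k, (k < n)%N -> C k (w k)].

Definition cylinders : set_system path :=
  [set A | exists n, exists2 C, (forall k, measurable (C k)) & A = cylinder n C].

Lemma measurable_cylinder n C : (forall k, measurable (C k)) ->
  measurable (cylinder n C).
Proof.
move=> mC.
have -> : cylinder n C = \bigcap_(k in `I_n) ((fun w : path => w k) @^-1` C k).
  by apply/seteqP; split=> w /= h k kn; exact: h.
apply: fin_bigcap_measurable => //k _; rewrite -[X in measurable X]setTI.
exact: measurable_path_coord.
Qed.

Lemma cylinders_setI : setI_closed cylinders.
Proof.
move=> _ _ [n [C mC ->]] [m [D mD ->]].
exists (maxn n m), (fun k => (if (k < n)%N then C k else setT) `&`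
                   (if (k < m)%N then D k else setT)).
  by move=> k; apply: measurableI; case: ifP => _.
apply/seteqP; split=> w /=.
  by move=> [hC hD] k _; split; case: ifPn => // km; [exact: hC|exact: hD].
move=> h; split=> k kn.
  by have [] := h k; rewrite ?kn// leq_max kn.
by have [_] := h k (leq_trans kn (leq_maxr _ _)); rewrite kn.
Qed.

Lemma path_measurableE : @measurable _ path = <<s cylinders >>.
Proof.
apply/seteqP; split=> A.
  apply: smallest_sub; first exact: smallest_sigma_algebra.
  move=> _ [k _ [B mB <-]]; apply: sub_sigma_algebra.
  exists k.+1, (fun i => if i == k then B else setT).
    by move=> i; case: ifP.
  rewrite setTI; apply/seteqP; split=> w /= h.
    by move=> i _; case: ifPn => // /eqP ->.
  by have := h k (ltnSn k); rewrite eqxx.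
apply: smallest_sub; first exact: sigma_algebra_measurable.
by move=> _ [n [C mC ->]]; exact: measurable_cylinder.
Qed.

Lemma path_measure_unique (R : realType) (m1 m2 : {measure set path -> \bar R}) :
  (forall n C, (forall k, measurable (C k)) ->
     m1 (cylinder n C) = m2 (cylinder n C)) ->
  (m1 setT < +oo)%E -> forall A, measurable A -> m1 A = m2 A.
Proof.
move=> h m1T.
apply: (measure_unique cylinders (fun=> setT)) => //.
- exact: path_measurableE.
- exact: cylinders_setI.
- move=> _; exists 0%N, (fun=> setT) => //.
  by apply/seteqP; split.
- by apply/seteqP; split => // w _; exists 0%N.
- by move=> _ [n [C mC ->]]; exact: h.
Qed.

End paths.

(** * Laws of Markov chains *)
Section markov.
Context d (X : measurableType d) (N : nat) (R : realType).
Variable mu : {sigma_finite_measure set X -> \bar R}.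
Local Notation Z := (X * 'I_N.+1)%type.
Local Notation path := (path_space X N).
Variable q : Z -> Z -> R.
Hypothesis qd : transition_density mu q.
Local Open Scope ereal_scope.

(** The expectation, from the initial state, of f at time n on a cylinder. The
    recursion splits off the first factor, as P_z does, whereas the Markov
    property in terms of conditional probabilities splits off the last one;
    [cylinder_integralS] reconciles the two. *)
Fixpoint cylinder_integral n (C : nat -> set Z) (f : Z -> \bar R) : Z -> \bar R :=
  if n is n'.+1 then fun z => (\1_(C 0%N) z)%:E *
    \int[ker qd z]_z' cylinder_integral n' (fun k => C k.+1) f z'
  else f.

Lemma cylinder_integralS n C f :
  cylinder_integral n.+1 C f =
  cylinder_integral n C (fun z => (\1_(C n) z)%:E * \int[ker qd z]_z' f z').
Proof.
elim: n C => //= n ih C; apply/funext => z; congr (_ * _).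
by rewrite -(ih (fun k => C k.+1)).
Qed.

Lemma cylinder_integral_ge0 n C f z : (forall z, 0 <= f z) ->
  0 <= cylinder_integral n C f z.
Proof.
move=> f0; elim: n C z => //= n ih C z.
by rewrite mule_ge0 ?lee_fin// integral_ge0.
Qed.

Lemma measurable_cylinder_integral n C f : (forall k, measurable (C k)) ->
  (forall z, 0 <= f z) -> measurable_fun setT f ->
  measurable_fun setT (cylinder_integral n C f).
Proof.
move=> mC f0 mf; elim: n C mC => //= n ih C mC.
apply: emeasurable_funM; first by apply/measurable_EFinP; exact: measurable_indic.
apply: measurable_integral_ker; last exact: ih.
by move=> z; exact: cylinder_integral_ge0.
Qed.

Section chain_law.
Context d' (Omega : measurableType d') (P : probability Omega R).
Variable Zs : nat -> Omega -> Z.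
Hypothesis Zs_markov : markov_chain mu q P Zs.

Let mZs k : (1 <= k)%N -> measurable_fun setT (Zs k).
Proof. by have [h _] := Zs_markov; exact: h. Qed.

Lemma sub_generators (I : set nat) : (forall k, I k -> (1 <= k)%N) ->
  <<s generators I Zs >> `<=` measurable.
Proof.
move=> I1; apply: smallest_sub; first exact: sigma_algebra_measurable.
by move=> _ [k /I1 k1 [A mA <-]]; exact: mZs.
Qed.

(** The conditional probabilities in the definition of a Markov chain give the
    image under Z_{k+1} of the restriction of P to B as a mixture of transition
    kernels. *)
Lemma markov_integral k B (f : Z -> \bar R) : (1 <= k)%N ->
  <<s generators [set i | (1 <= i <= k)%N] Zs >> B ->
  (forall z, 0 <= f z) -> measurable_fun setT f ->
  \int[P]_(w in B) f (Zs k.+1 w) = \int[P]_(w in B) \int[ker qd (Zs k w)]_z' f z'.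
Proof.
move=> k1 GB f0 mf.
have mB : measurable B.
  by apply: sub_generators GB => i /= /andP[].
have mZk := mZs (leqW k1).
pose m := pushforward (mrestr P mB) (Zs k.+1).
have mZU (U : set Z) : measurable U -> measurable (Zs k.+1 @^-1` U).
  by move=> mU; rewrite -[X in measurable X]setTI; exact: mZk.
transitivity (\int[m]_z f z).
  rewrite -(@ge0_integral_mixture _ _ _ _ _ P B (fun w => \d_(Zs k.+1 w)) m)//.
  - by apply: eq_integral => w _; rewrite integral_dirac// diracT mul1e.
  - move=> U mU; apply/measurable_EFinP.
    exact: measurableT_comp (measurable_indic mU) mZk.
  - move=> U mU; rewrite /m /= /pushforward /mrestr -integral_indic//; last exact: mZU.
rewrite (@ge0_integral_mixture _ _ _ _ _ P B (fun w => ker qd (Zs k w)) m)//.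
- by move=> U mU; apply: measurableT_comp (measurable_ker qd mU) _; exact: mZs.
- move=> U mU; have [_ /(_ k U k1 mU) [_ _ /(_ B GB)]] := Zs_markov.
  by rewrite /ker.
Qed.

Lemma markov_cylinder n C f : (forall k, measurable (C k)) ->
  (forall z, 0 <= f z) -> measurable_fun setT f ->
  \int[P]_(w in [set w | forall k, (k < n)%N -> C k (Zs k.+1 w)]) f (Zs n.+1 w) =
  \int[P]_w cylinder_integral n C f (Zs 1%N w).
Proof.
move=> mC; elim: n f => [|n ih] f f0 mf.
  by congr (integral _ _ _); apply/seteqP; split.
set B := [set w | _].
have mCZ k : measurable (Zs k.+1 @^-1` C k).
  by rewrite -[X in measurable X]setTI; exact: mZs.
pose B' := [set w | forall k, (k < n)%N -> C k (Zs k.+1 w)].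
have BE : B = B' `&` Zs n.+1 @^-1` C n.
  apply/seteqP; split=> w /=.
    by move=> h; split; [move=> k kn; apply: h; rewrite ltnS ltnW | exact: h].
  move=> [h1 h2] k; rewrite ltnS leq_eqVlt => /orP[/eqP -> //|]; exact: h1.
have mB' : measurable B'.
  have -> : B' = \bigcap_(k in `I_n) (Zs k.+1 @^-1` C k) by [].
  exact: fin_bigcap_measurable.
rewrite (@markov_integral n.+1)//; last first.
  have -> : B = \bigcap_(k in `I_n.+1) (Zs k.+1 @^-1` C k) by [].
  apply: (@fin_bigcap_measurable _ (g_sigma_algebraType _)) => // k kn.
  apply: sub_sigma_algebra; exists k.+1 => //.
  by exists (C k) => //; rewrite setTI.
rewrite cylinder_integralS -ih; last 2 first.
- by move=> z; rewrite mule_ge0 ?lee_fin// integral_ge0.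
- apply: emeasurable_funM; first by apply/measurable_EFinP; exact: measurable_indic.
  exact: measurable_integral_ker.
rewrite BE setIC integral_mkcondl; apply: eq_integral => w _.
rewrite patchE indicE; case: ifPn => h.
  by rewrite mem_set ?mul1e//; exact: (set_mem h).
by rewrite memNset ?mul0e//; move/negP: h => h h'; apply: h; exact: mem_set.
Qed.

Lemma markov_cylinder_prob n C : (forall k, measurable (C k)) ->
  P [set w | forall k, (k < n)%N -> C k (Zs k.+1 w)] =
  \int[P]_w cylinder_integral n C (cst 1) (Zs 1%N w).
Proof.
move=> mC; rewrite -(markov_cylinder n)//.
rewrite integral_cst ?mul1e//.
have -> : [set w | forall k, (k < n)%N -> C k (Zs k.+1 w)] =
   \bigcap_(k in `I_n) (Zs k.+1 @^-1` C k) by [].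
apply: fin_bigcap_measurable => // k _.
by rewrite -[X in measurable X]setTI; exact: mZs.
Qed.

Definition trajectory (w : Omega) : path := fun k => Zs k.+1 w.

Lemma measurable_trajectory : measurable_fun setT trajectory.
Proof. by apply: measurable_to_path => k; exact: mZs. Qed.

End chain_law.

Variable Pz : Z -> probability path R.
Hypothesis Pz_law : forall z, law_from mu q z (Pz z).

Lemma Pz_cylinder z n C : (forall k, measurable (C k)) ->
  Pz z (cylinder n C) = cylinder_integral n C (cst 1) z.
Proof.
move=> mC; have [mk ini] := Pz_law z.
rewrite /cylinder [LHS](markov_cylinder_prob mk)//.
have mc1 : measurable_fun setT (@Defs.coord _ X N 1%N).
  by have [h _] := mk; exact: h.
have mg : measurable_fun setT (cylinder_integral n C (cst 1)).
  by apply: measurable_cylinder_integral => //; exact: measurable_cst.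
have g0 z' : 0 <= cylinder_integral n C (cst 1) z' by exact: cylinder_integral_ge0.
transitivity (\int[pushforward (Pz z) (@Defs.coord _ X N 1%N)]_z'
    cylinder_integral n C (cst 1) z').
  by rewrite ge0_integral_pushforward.
rewrite (@eq_measure_integral _ _ _ _ (\d_z))//.
  by rewrite integral_dirac// diracT mul1e.
by move=> A mA _; first [exact: ini | exact/esym/ini].
Qed.

(** On cylinders the probability is an iterated kernel integral, hence measurable
    in z; Dynkin's lemma extends this to all events. *)
Lemma measurable_Pz A : measurable A -> measurable_fun setT (fun z => Pz z A).
Proof.
rewrite path_measurableE => GA; move: A GA.
apply: (@dynkin_induction _ path (@cylinders _ X N)).
- exact: path_measurableE.
- exact: cylinders_setI.
- under eq_fun do rewrite probability_setT; exact: measurable_cst.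
- move=> _ [n [C mC ->]]; under eq_fun do rewrite Pz_cylinder//.
  by apply: measurable_cylinder_integral => //; exact: measurable_cst.
- move=> A mA ih; under eq_fun do rewrite probability_setC//.
  by apply: emeasurable_funB => //; exact: measurable_cst.
- move=> F mF tF ih.
  have E z : Pz z (\bigcup_k F k) = \sum_(n <oo) Pz z (F n).
    by rewrite measure_semi_bigcup//; exact: bigcupT_measurable.
  rewrite (funext E); apply: ge0_emeasurable_sum => //.
Qed.

(** The first two arguments are recorded in the term because its measure
    structure is built from them. *)
Definition mixture_law (_ : transition_density mu q)
  (_ : forall z, law_from mu q z (Pz z)) d' (T : measurableType d') (l : T -> Z)
  (_ : measurable_fun setT l) (m : {measure set T -> \bar R}) (A : set path) : \bar R :=
  \int[m]_t Pz (l t) A.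

Section mixture_law.
Context d' (T : measurableType d') (l : T -> Z) (ml : measurable_fun setT l).
Variable m : {measure set T -> \bar R}.

Let mPzl A : measurable A -> measurable_fun setT (fun t => Pz (l t) A).
Proof. by move=> mA; exact: measurableT_comp (measurable_Pz mA) ml. Qed.

Let mix0 : mixture_law qd Pz_law ml m set0 = 0.
Proof. by rewrite /mixture_law integral0_eq. Qed.

Let mix_ge0 A : 0 <= mixture_law qd Pz_law ml m A.
Proof. exact: integral_ge0. Qed.

Let mix_sigma_additive : semi_sigma_additive (mixture_law qd Pz_law ml m).
Proof.
move=> F mF tF mUF; rewrite [X in _ --> X](_ : _ = \sum_(n <oo) mixture_law qd Pz_law ml m (F n)).
  by apply/cvg_closeP; split; [exact: is_cvg_nneseries|rewrite closeE].
rewrite -integral_nneseries//; last by move=> n; exact: mPzl.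
by apply: eq_integral => t _; rewrite measure_semi_bigcup.
Qed.

HB.instance Definition _ := isMeasure.Build _ _ _ (mixture_law qd Pz_law ml m)
  mix0 mix_ge0 mix_sigma_additive.

End mixture_law.

(** First-step analysis: both sides are measures in A that agree on cylinders.
    Under the laws P_z the Markov property is only used in this form, by
    induction on the number of steps. *)
Lemma Pz_step z A : measurable A ->
  Pz z A = \int[ker qd z]_z' Pz z' (path_cons z @^-1` A).
Proof.
move=> mA.
pose m := mixture_law qd Pz_law (measurable_id (D := setT)) (ker qd z : {measure set Z -> \bar R}).
have mc := @measurable_path_cons _ X N z.
transitivity (pushforward m (path_cons z) A); last by [].
apply: path_measure_unique => //; last first.
  by have := probability_setT (Pz z) => /= ->; rewrite ltry.
move=> n C mC.
transitivity (cylinder_integral n C (cst 1) z); first exact: Pz_cylinder.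
rewrite /= /pushforward/= /m /mixture_law.
case: n => [|n] /=.
  rewrite (_ : _ @^-1` _ = setT); last by apply/seteqP; split.
  under eq_integral do rewrite probability_setT.
  by rewrite integral_cst// mul1e; exact/esym/ker_setT.
have [Cz|Cz] := boolP (z \in C 0%N); rewrite indicE.
  rewrite Cz mul1e; apply: eq_integral => z' _.
  rewrite -Pz_cylinder//; congr (Pz z' _); apply/seteqP; split => w /= h.
    by move=> [_|k] /=; [exact: set_mem|exact: h].
  by move=> k kn; exact: (h k.+1).
rewrite (negbTE Cz) mul0e integral0_eq// => z' _.
rewrite (_ : _ @^-1` _ = set0) ?measure0//.
apply/seteqP; split=> w //= /(_ 0%N (ltn0Sn _)) /= h.
by move/negP: Cz; apply; exact: mem_set.
Qed.

(** The law of the whole chain is determined by its cylinders; this carries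
    statements about the laws P_z over to P. *)
Lemma trajectory_law d' (Omega : measurableType d') (P : probability Omega R)
    (Zs : nat -> Omega -> Z) (Zs_markov : markov_chain mu q P Zs) A :
  measurable A ->
  P (trajectory Zs @^-1` A) = \int[P]_w Pz (Zs 1%N w) A.
Proof.
move=> mA.
have mZ1 : measurable_fun setT (Zs 1%N) by have [h _] := Zs_markov; exact: h.
have mt := measurable_trajectory Zs_markov.
transitivity (pushforward P (trajectory Zs) A) => //.
transitivity (mixture_law qd Pz_law mZ1 P A) => //.
apply: path_measure_unique => //; last first.
  by rewrite /= /pushforward preimage_setT probability_setT ltry.
move=> n C mC; rewrite /= /pushforward /mixture_law.
rewrite -[_ @^-1` _]/[set w | forall k, (k < n)%N -> C k (Zs k.+1 w)].
rewrite (markov_cylinder_prob Zs_markov)//.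
by apply: eq_integral => w _; rewrite Pz_cylinder.
Qed.

End markov.

(** * Levy's zero-one law *)
Section approximation.
Context d (X : measurableType d) (N : nat) (R : realType).
Local Notation Z := (X * 'I_N.+1)%type.
Local Notation path := (path_space X N).
Local Open Scope ereal_scope.

Definition determined n (A : set path) : Prop :=
  forall w w', (forall k, (k < n)%N -> w k = w' k) -> A w -> A w'.

Lemma determined_le n m A : (n <= m)%N -> determined n A -> determined m A.
Proof. by move=> nm dA w w' ww'; apply: dA => k kn; apply: ww'; exact: leq_trans nm. Qed.

Lemma determinedC n A : determined n A -> determined n (~` A).
Proof. by move=> dA w w' ww' Aw /(dA _ w)-/(_ (fun k kn => esym (ww' k kn))). Qed.

Lemma determinedU n A B : determined n A -> determined n B -> determined n (A `|` B).
Proof. by move=> dA dB w w' ww' [/(dA _ _ ww')|/(dB _ _ ww')]; [left|right]. Qed.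

Lemma determinedI n A B : determined n A -> determined n B -> determined n (A `&` B).
Proof. by move=> dA dB w w' ww' [/(dA _ _ ww') ? /(dB _ _ ww')]. Qed.

Variable Q : probability path R.

Definition approximable (B : set path) := forall e : R, (0 < e)%R ->
  exists n A, [/\ measurable A, determined n A & Q (A `+` B) <= e%:E].

Lemma approximableU A B : measurable A -> measurable B ->
  approximable A -> approximable B -> approximable (A `|` B).
Proof.
move=> mA mB aA aB e e0.
have e20 : (0 < e / 2)%R by rewrite divr_gt0.
have [n [A' [mA' dA' QA]]] := aA _ e20.
have [m [B' [mB' dB' QB]]] := aB _ e20.
exists (maxn n m), (A' `|` B'); split.
- exact: measurableU.
- by apply: determinedU; [apply: determined_le dA'|apply: determined_le dB'];
    rewrite ?leq_maxl ?leq_maxr.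
- have mAA : measurable (A' `+` A) by apply: measurableU; exact: measurableD.
  have mBB : measurable (B' `+` B) by apply: measurableU; exact: measurableD.
  rewrite (splitr e) EFinD; apply: (le_trans _ (leeD QA QB)).
  apply: (le_trans _ (measureU2 _ mAA mBB)); apply: measure_mono.
  + by apply: measurableU; apply: measurableD; exact: measurableU.
  + exact: measurableU.
  + move=> w; rewrite /setY/=; tauto.
Qed.

(** Events of finite horizon are stable under complements and finite unions, and
    a countable disjoint union is close to its finite subunions; Dynkin's lemma
    applies because cylinders have a finite horizon. *)
Lemma approximable_measurable B : measurable B -> approximable B.
Proof.
rewrite path_measurableE => GB; move: B GB.
apply: (@dynkin_induction _ path (@cylinders _ X N)).
- exact: path_measurableE.
- exact: cylinders_setI.
- move=> e e0; exists 0%N, setT; split => //.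
  by rewrite setYK measure0 lee_fin ltW.
- move=> _ [n [C mC ->]] e e0; exists n, (cylinder n C); split => //.
  + exact: measurable_cylinder.
  + by move=> w w' ww' h k kn; rewrite -ww'//; exact: h.
  + by rewrite setYK measure0 lee_fin ltW.
- move=> A mA ih e e0; have [n [A' [mA' dA' QA]]] := ih e e0.
  exists n, (~` A'); split; [exact: measurableC|exact: determinedC|].
  apply: le_trans QA; apply: measure_mono => //.
  + by apply: measurableU; apply: measurableD; exact: measurableC.
  + by apply: measurableU; exact: measurableD.
  + move=> w; rewrite /setY/=.
    by move=> [[a /contrapT b]|[a /contrapT b]]; [right|left].
- move=> F mF tF ih.
  pose U m := \big[setU/set0]_(k < m) F k.
  have mU m : measurable (U m) by exact: bigsetU_measurable.
  have aU m : approximable (U m).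
    elim: m => [|m ihm]; last first.
      rewrite /U big_ord_recr/=.
      apply: approximableU; [exact: mU|exact: mF|exact: ihm|exact: ih].
    rewrite /U big_ord0 => e e0; exists 0%N, set0; split => //.
    by rewrite setYK measure0 lee_fin ltW.
  have mUF : measurable (\bigcup_k F k) by exact: bigcupT_measurable.
  have EU : \bigcup_k F k = \bigcup_m U m.
    apply/seteqP; split=> w [k _ h].
      by exists k.+1 => //; rewrite /U big_ord_recr; right.
    by move: h; rewrite /U -bigcup_mkord => -[i _ Fi]; exists i.
  have ndU : nondecreasing_seq U.
    by move=> m n mn; apply/subsetPset/subset_bigsetU.
  have D0 : \bigcap_m (\bigcup_k F k `\` U m) = set0.
    apply/seteqP; split=> w //= h; have [[k _ Fkw] _] := h 0%N I.
    by have [_] := h k.+1 I; apply; rewrite /U big_ord_recr; right.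
  have cvgD : Q \o (fun m => \bigcup_k F k `\` U m) @ \oo --> 0.
    rewrite -(measure0 Q) -D0; apply: nonincreasing_cvg_mu.
    - by rewrite (le_lt_trans (probability_le1 _ _)) ?ltry//; exact: measurableD.
    - by move=> m; exact: measurableD.
    - by rewrite D0.
    - by move=> m n mn; apply/subsetPset; apply: setDS; apply/subsetPset; exact: ndU.
  move=> e e0; have e20 : (0 < e / 2)%R by rewrite divr_gt0.
  have [m Qm] : exists m, Q (\bigcup_k F k `\` U m) <= (e / 2)%:E.
    apply: contrapT => /forallNP hm.
    have : (e / 2)%:E <= limn (Q \o (fun m => \bigcup_k F k `\` U m)).
      apply: lime_ge; first by apply/cvg_ex; eexists; exact: cvgD.
      by exists 0%N => // m _ /=; rewrite ltW// ltNge; exact/negP.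
    by rewrite (cvg_lim _ cvgD)// lee_fin leNgt e20.
  have [n [A [mA dA QA]]] := aU m _ e20.
  exists n, A; split => //.
  rewrite (splitr e) EFinD; apply: (le_trans _ (leeD QA Qm)).
  have mAA : measurable (A `+` U m) by apply: measurableU; exact: measurableD.
  have mBB : measurable (\bigcup_k F k `\` U m) by exact: measurableD.
  apply: (le_trans _ (measureU2 _ mAA mBB)); apply: measure_mono.
  + by apply: measurableU; exact: measurableD.
  + exact: measurableU.
  + have sU : U m `<=` \bigcup_k F k by rewrite EU; exact: bigcup_sup.
    move=> w; rewrite /setY/=; have [hU|hU] := pselect (U m w).
      by have := sU _ hU; tauto.
    tauto.
Qed.

(** Approximate the complement of G by an event A of finite horizon: Q (A `&` G)
    is then small, hence so are Q A, by the hypothesis, and Q (~` G). *)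
Lemma levy_zero_one G (delta : R) : measurable G -> (0 < delta)%R ->
  (forall n A, measurable A -> determined n A ->
     delta%:E * Q A <= Q (A `&` G)) -> Q G = 1.
Proof.
move=> mG d0 h.
suff Q0 : Q (~` G) = 0.
  by rewrite -(setCK G) probability_setC ?Q0 ?sube0//; exact: measurableC.
have mGC : measurable (~` G) by exact: measurableC.
apply/eqP; rewrite eq_le measure_ge0 andbT.
apply/lee_addgt0Pr => e e0; rewrite add0e.
have e1 : (0 < e / (delta^-1 + 1))%R by rewrite divr_gt0// addr_gt0// invr_gt0.
have [n [A [mA dA QA]]] := approximable_measurable mGC e1.
have mY : measurable (A `+` ~` G) by apply: measurableU; apply: measurableD.
have QAG : delta%:E * Q A <= (e / (delta^-1 + 1))%:E.
  apply: (le_trans (h n A mA dA)); apply: le_trans QA.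
  apply: measure_mono => //; first exact: measurableI.
  by move=> w [Aw Gw]; left; split.
have QA' : Q A <= (delta^-1 * (e / (delta^-1 + 1)))%:E.
  by rewrite EFinM lee_pdivlMl.
rewrite [leRHS](_ : _ = (delta^-1 * (e / (delta^-1 + 1)))%:E + (e / (delta^-1 + 1))%:E).
  apply: le_trans (leeD QA' QA).
  apply: le_trans (measureU2 _ mA mY); apply: measure_mono => //.
    exact: measurableU.
  move=> w Gw; have [Aw|Aw] := pselect (A w); first by left.
  by right; right; split.
rewrite -EFinD; congr EFin; apply/esym; rewrite -[X in (_ + X)%R]mul1r -mulrDl mulrC divfK//.
by rewrite gt_eqF// addr_gt0// invr_gt0.
Qed.

End approximation.

(** * Recurrence of path events *)
Section splice.
Context d (X : measurableType d) (N : nat).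
Local Notation Z := (X * 'I_N.+1)%type.
Local Notation path := (path_space X N).

Fixpoint splice k (w0 w : path) : path :=
  if k is k'.+1 then path_cons (w0 0%N) (splice k' (shift 1 w0) w) else w.

Lemma splice_lt k w0 w i : (i < k)%N -> splice k w0 w i = w0 i.
Proof. by elim: k w0 i => // k ih w0 [|i] //= ik; rewrite ih. Qed.

Lemma splice_add k w0 w i : splice k w0 w (k + i)%N = w i.
Proof. by elim: k w0 => //= k ih w0; rewrite ih. Qed.

Lemma splice_eq k w0 w : splice k w0 w k = w 0%N.
Proof. by rewrite -[RHS](splice_add k w0) addn0. Qed.

Lemma shift_splice k w0 w : shift k (splice k w0 w) = w.
Proof. by apply/funext => i; rewrite /shift splice_add. Qed.

Lemma measurable_splice k w0 : measurable_fun setT (splice k w0).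
Proof.
elim: k w0 => [|k ih] w0; first exact: measurable_id.
exact: measurableT_comp (measurable_path_cons _) (ih _).
Qed.

End splice.

Section hitting.
Context d (X : measurableType d) (N : nat) (R : realType).
Variable mu : {sigma_finite_measure set X -> \bar R}.
Local Notation Z := (X * 'I_N.+1)%type.
Local Notation path := (path_space X N).
Variable q : Z -> Z -> R.
Hypothesis qd : transition_density mu q.
Variable Pz : Z -> probability path R.
Hypothesis Pz_law : forall z, law_from mu q z (Pz z).
Local Open Scope ereal_scope.

(** An inequality that holds conditionally on every past up to time k holds under
    P_z. The past is a path w0, whose coordinates 0, ..., k matter. *)
Lemma Pz_le_splice k z (c : R) A B : (0 <= c)%R -> measurable A -> measurable B ->
  (forall w0, c%:E * Pz (w0 k) (splice k w0 @^-1` A) <=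
              Pz (w0 k) (splice k w0 @^-1` B)) ->
  c%:E * Pz z A <= Pz z B.
Proof.
move=> c0; elim: k z A B => [|k ih] z A B mA mB h.
  exact: (h (fun=> z)).
have mcA := measurable_preimage (measurable_path_cons z) mA.
have mcB := measurable_preimage (measurable_path_cons z) mB.
rewrite !(Pz_step qd Pz_law z)// -ge0_integralZl_EFin//; last first.
  exact: (measurable_Pz qd Pz_law).
apply: ge0_le_integral => //.
- by move=> z' _; rewrite mule_ge0.
- by apply: measurable_funeM; exact: (measurable_Pz qd Pz_law).
- exact: (measurable_Pz qd Pz_law).
- move=> z' _; apply: ih => // w0.
  exact: (h (path_cons z w0)).
Qed.

(** The initial state is z almost surely. Substituting z for it avoids the event
    that it equals z, which need not be measurable. *)
Lemma Pz_head z A : measurable A ->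
  Pz z A = Pz z [set w | A (path_cons z (shift 1 w))].
Proof.
move=> mA; rewrite !(Pz_step qd Pz_law z)//.
have -> : [set w | A (path_cons z (shift 1 w))] =
    (path_cons z \o @shift _ X N 1) @^-1` A by [].
apply: measurable_preimage => //.
apply: measurableT_comp; [exact: measurable_path_cons|exact: measurable_shift].
Qed.

Lemma Pz_determined1 z A w : measurable A -> determined 1 A -> A (path_cons z w) ->
  Pz z A = 1.
Proof.
move=> mA dA Aw; rewrite Pz_head// -[RHS](probability_setT (Pz z)); congr (Pz z _).
by apply/seteqP; split=> // w' _ /=; apply: dA Aw => -[].
Qed.

Lemma Pz_determined1_0 z A : measurable A -> determined 1 A ->
  (forall w, ~ A (path_cons z w)) -> Pz z A = 0.
Proof.
move=> mA dA Aw; rewrite Pz_head// -[RHS](measure0 (Pz z)); congr (Pz z _).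
by apply/seteqP; split=> // w' /= /Aw.
Qed.

Lemma markov_lower_bound k z (delta : R) (D : set Z) (A G : set path) :
  (0 <= delta)%R -> measurable A -> measurable G -> determined k.+1 A ->
  (forall w, A w -> D (w k)) -> (forall z, D z -> delta%:E <= Pz z G) ->
  delta%:E * Pz z A <= Pz z (A `&` shift k @^-1` G).
Proof.
move=> d0 mA mG dA AD DG.
have mGk : measurable (shift k @^-1` G) by exact: measurable_preimage (measurable_shift k) mG.
have mAG : measurable (A `&` shift k @^-1` G) by exact: measurableI.
apply: (@Pz_le_splice k) => // w0.
have mA' := measurable_preimage (measurable_splice k w0) mA.
have dA' : determined 1 (splice k w0 @^-1` A).
  move=> w w' ww'; apply: dA => i; rewrite ltnS leq_eqVlt => /orP[/eqP ->|ik].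
    by rewrite !splice_eq ww'.
  by rewrite !splice_lt.
have [[w Aw]|nA] := pselect (exists w, A (splice k w0 (path_cons (w0 k) w))); last first.
  rewrite Pz_determined1_0 ?mule0//.
  by move=> w Aw; apply: nA; exists w.
rewrite (Pz_determined1 mA' dA' Aw) mule1.
have Dz : D (w0 k).
  by have := AD _ Aw; rewrite splice_eq.
apply: (le_trans (DG _ Dz)).
rewrite [leRHS]Pz_head; last exact: measurable_preimage (measurable_splice k w0) mAG.
rewrite [leLHS]Pz_head//.
apply: measure_mono.
- apply: (measurable_preimage (f := path_cons (w0 k) \o @shift _ X N 1)) => //.
  by apply: measurableT_comp; [exact: measurable_path_cons|exact: measurable_shift].
- apply: (measurable_preimage (f := splice k w0 \o (path_cons (w0 k) \o @shift _ X N 1))) => //.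
  apply: measurableT_comp; first exact: measurable_splice.
  by apply: measurableT_comp; [exact: measurable_path_cons|exact: measurable_shift].
- move=> w' /= Gw'; split; last by rewrite shift_splice.
  by apply: (dA' _ _ _ Aw) => -[].
Qed.

Definition visited_io (D : set Z) : set path :=
  [set w | forall n, exists2 k, (n <= k)%N & D (w k)].

Definition io (G : set path) : set path :=
  [set w | forall n, exists2 k, (n <= k)%N & G (shift k w)].

Let ioE (G : set path) :
  io G = \bigcap_n \bigcup_(k in [set k | (n <= k)%N]) (shift k @^-1` G).
Proof.
apply/seteqP; split=> w /= h n; first by move=> _; have [k nk Gk] := h n; exists k.
by have [k nk Gk] := h n I; exists k.
Qed.

Lemma measurable_io G : measurable G -> measurable (io G).
Proof.
move=> mG; rewrite ioE; apply: bigcapT_measurable => n; apply: bigcup_measurable => k _.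
exact: measurable_preimage (measurable_shift k) mG.
Qed.

(** Let A be an event determined by the coordinates before n, and m >= n. Split A
    according to the first visit to D after time m: from there on G has
    probability at least delta, so that A meets the event that G occurs after
    time m in probability at least delta * P_z A. Let m tend to infinity and apply
    [levy_zero_one]. *)
Lemma io_one z (D : set Z) (G : set path) (delta : R) :
  measurable D -> measurable G -> (0 < delta)%R ->
  (forall z, D z -> delta%:E <= Pz z G) -> Pz z (visited_io D) = 1 ->
  Pz z (io G) = 1.
Proof.
move=> mD mG d0 DG D1.
apply: (levy_zero_one _ d0); first exact: measurable_io.
have d0' := ltW d0.
move=> n A mA dA.
pose GN m := \bigcup_(k in [set k | (m <= k)%N]) (@shift _ X N k @^-1` G).
have mGN m : measurable (GN m).
  by apply: bigcup_measurable => k _; exact: measurable_preimage (measurable_shift k) mG.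
have mcoord k : measurable [set w : path | D (w k)].
  exact: measurable_preimage (measurable_path_coord k) mD.
have GNge m : (n <= m)%N -> delta%:E * Pz z A <= Pz z (A `&` GN m).
  move=> nm.
  (* T k: the first visit to D after time m takes place at time k *)
  pose T k := [set w : path | [/\ (m <= k)%N, D (w k) &
                 forall j, (m <= j < k)%N -> ~ D (w j)]].
  have mT k : measurable (T k).
    have [mk|km] := leqP m k; last first.
      by rewrite (_ : T k = set0)//; apply/seteqP; split => // w [mk]; move: km; rewrite ltnNge mk.
    rewrite (_ : T k = [set w : path | D (w k)] `&`
       \bigcap_(j in [set j | (m <= j < k)%N]) ~` [set w : path | D (w j)]).
      apply: measurableI => //; apply: bigcap_measurableType => j _; exact: measurableC.
    by apply/seteqP; split=> w; [move=> [_ Dk h]; split|move=> [Dk h]; split].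
  have tT : trivIset setT T.
    apply/trivIsetP => i j _ _ ij; apply/seteqP; split=> // w [[mi Di hi] [mj Dj hj]].
    have [ltij|ltji|eij] := ltngtP i j.
    - by apply: (hj i) => //; rewrite mi.
    - by apply: (hi j) => //; rewrite mj.
    - by rewrite eij eqxx in ij.
  have UT : visited_io D `<=` \bigcup_k T k.
    move=> w h.
    have ex : exists k, (m <= k)%N && `[< D (w k) >].
      by have [k mk Dk] := h m; exists k; rewrite mk; apply/asboolP.
    case: (ex_minnP ex) => k /andP[mk /asboolP Dk] hmin.
    exists k => //; split => // j /andP[mj jk] Dj.
    by move: jk; rewrite ltnNge hmin// mj; apply/asboolP.
  have UT1 : Pz z (\bigcup_k T k) = 1.
    apply/eqP; rewrite eq_le probability_le1 ?andTb//; last exact: bigcupT_measurable.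
    rewrite -D1 measure_mono//.
      pose F (k : nat) := [set w : path | D (w k)].
      rewrite (_ : visited_io D = \bigcap_n \bigcup_(k in [set k | (n <= k)%N]) F k).
        by apply: bigcapT_measurable => i; apply: bigcup_measurable => k _; exact: mcoord.
      apply/seteqP; split=> w /= h i; first by move=> _; have [k nk Gk] := h i; exists k.
      by have [k nk Gk] := h i I; exists k.
    exact: bigcupT_measurable.
  have mAT k : measurable (A `&` T k) by exact: measurableI.
  have mATG k : measurable (A `&` T k `&` shift k @^-1` G).
    by apply: measurableI => //; exact: measurable_preimage (measurable_shift k) mG.
  have tAT : trivIset setT (fun k => A `&` T k).
    by apply: trivIset_setIl.
  have -> : Pz z A = \sum_(k <oo) Pz z (A `&` T k).
    rewrite -measure_semi_bigcup//; last exact: bigcupT_measurable.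
    rewrite -setI_bigcupr.
    have mUT : measurable (\bigcup_k T k) by exact: bigcupT_measurable.
    have UT0 : Pz z (~` (\bigcup_k T k)) = 0 by rewrite probability_setC// UT1 subee.
    rewrite -[in LHS](setIT A) -(setUv (\bigcup_k T k)) setIUr measureU//.
    - rewrite [X in _ + X](_ : _ = 0) ?adde0//; apply/eqP.
      rewrite eq_le measure_ge0 andbT -UT0 measure_mono//.
      + by apply: measurableI => //; exact: measurableC.
      + exact: measurableC.
    - exact: measurableI.
    - by apply: measurableI => //; exact: measurableC.
    - by rewrite setIACA setICr setI0.
  rewrite -nneseriesZl//.
  have S2 : \sum_(k <oo) Pz z (A `&` T k `&` shift k @^-1` G) <= Pz z (A `&` GN m).
    rewrite -measure_semi_bigcup//.
    + apply: measure_mono; [exact: bigcupT_measurable|exact: measurableI|].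
      by move=> w [k _ [[Aw [mk _ _]] Gk]]; split => //; exists k.
    + apply/trivIsetP => i j _ _ ij.
      move/trivIsetP : tAT => /(_ i j I I ij) E.
      by rewrite setIACA E set0I.
    + exact: bigcupT_measurable.
  apply: le_trans S2; apply: lee_nneseries => k _.
    by rewrite mule_ge0.
  apply: (@markov_lower_bound k z delta D) => //.
  - have [mk|km] := leqP m k; last first.
      move=> w w' _ [_ [mk]]; by move: km; rewrite ltnNge mk.
    apply: determinedI; first by apply: determined_le dA; exact: leq_trans nm (leqW mk).
    move=> w w' ww' [_ Dk h]; split => //; first by rewrite -ww'.
    by move=> j /andP[mj jk]; rewrite -(ww' j (leqW jk)); apply: h; rewrite mj.
  - by move=> w [_ []].
have -> : A `&` io G = \bigcap_m (A `&` GN m).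
  rewrite ioE; apply/seteqP; split=> w.
    by move=> [Aw h] i _; split => //; exact: h.
  by move=> h; split; [have [] := h 0%N I|move=> i _; have [] := h i I].
have cvgG : Pz z \o (fun m => A `&` GN m) @ \oo --> Pz z (\bigcap_m (A `&` GN m)).
  apply: nonincreasing_cvg_mu.
  - by rewrite (le_lt_trans (probability_le1 _ _)) ?ltry//; exact: measurableI.
  - by move=> m; exact: measurableI.
  - by apply: bigcapT_measurable => m; exact: measurableI.
  - move=> a b ab; apply/subsetPset => w [Aw [k /= bk Gk]]; split => //.
    by exists k => //=; exact: leq_trans bk.
rewrite -(cvg_lim _ cvgG)//; apply: lime_ge; first by apply/cvg_ex; eexists; exact: cvgG.
by exists n => // m /= nm; exact: GNge.
Qed.

Variable psi : {sigma_finite_measure set Z -> \bar R}.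
Hypothesis Z_harris : harris_recurrent Pz psi.

Lemma harris_io (D : set Z) (G : set path) (delta : R) :
  measurable D -> measurable G -> 0 < psi D -> (0 < delta)%R ->
  (forall z, D z -> delta%:E <= Pz z G) -> forall z, Pz z (io G) = 1.
Proof.
move=> mD mG pD d0 DG z; apply: (@io_one z D G delta) => //.
(* coord k reads the path at k.-1: the two ways to visit D infinitely often
   differ by a shift of one *)
have [_ /(_ D mD pD z)] := Z_harris; move=> <-; congr (Pz z _).
apply/seteqP; split=> w /=.
  move=> h n _; have [k nk Dk] := h n; exists k.+1 => //=; exact: leqW.
move=> h n; have [k /= nk Dk] := h n.+1 I; exists k.-1 => //.
by rewrite -ltnS; case: k nk Dk.
Qed.

End hitting.

(** * Linear growth of the number of visits *)
Section tally.
Implicit Types (p : nat -> bool).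

Definition tally p n : nat := (\sum_(k < n) p k)%N.

Lemma tally0 p : tally p 0 = 0%N. Proof. by rewrite /tally big_ord0. Qed.

Lemma tallyS p n : tally p n.+1 = (p 0%N + tally (fun k => p k.+1) n)%N.
Proof. by rewrite /tally big_ord_recl. Qed.

Lemma tallyD p m n : tally p (m + n) = (tally p m + tally (fun k => p (m + k)%N) n)%N.
Proof. by elim: m p => [|m ih] p; rewrite ?tally0// addSn !tallyS ih addnA. Qed.

Lemma tally_le p n : (tally p n <= n)%N.
Proof.
elim: n p => [|n ih] p; first by rewrite tally0.
by have := ih (fun k => p k.+1); rewrite tallyS; case: (p 0%N); lia.
Qed.

End tally.

Section linear_growth.
Context d (X : measurableType d) (N : nat) (R : realType).
Variable mu : {sigma_finite_measure set X -> \bar R}.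
Local Notation Z := (X * 'I_N.+1)%type.
Local Notation path := (path_space X N).
Variable q : Z -> Z -> R.
Hypothesis qd : transition_density mu q.
Variable Pz : Z -> probability path R.
Hypothesis Pz_law : forall z, law_from mu q z (Pz z).
Local Open Scope ereal_scope.

Definition visits (B : set path) n (w : path) : nat :=
  tally (fun k => `[< B (shift k w) >]) n.

(** A positive lower density of visits, in integers: the constant K makes the
    event invariant under shifts. *)
Definition linear_visits (B : set path) (M : nat) : set path :=
  [set w | exists K, forall n, (n <= M * visits B n w + K)%N].

Lemma shiftD i j (w : path) : shift i (shift j w) = shift (j + i) w.
Proof. by apply/funext => k; rewrite /shift addnA. Qed.

Lemma visitsS B n w : visits B n.+1 w = (`[< B w >] + visits B n (shift 1 w))%N.
Proof. by rewrite /visits tallyS. Qed.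

Lemma visitsD B m n w : visits B (m + n) w = (visits B m w + visits B n (shift m w))%N.
Proof.
rewrite /visits tallyD; congr (_ + tally _ _)%N.
by apply/funext => k; rewrite shiftD.
Qed.

Lemma visits_le B n w : (visits B n w <= n)%N.
Proof. exact: tally_le. Qed.

Lemma linear_visits_shift B M k w :
  linear_visits B M (shift k w) <-> linear_visits B M w.
Proof.
split=> -[K h].
  exists (K + k)%N => n.
  have [nk|kn] := leqP n k.
    by rewrite (leq_trans nk)// addnA leq_addl.
  have := h (n - k)%N; rewrite leq_subLR => /leq_trans; apply.
  rewrite -{2}(subnKC (ltnW kn)) visitsD mulnDr; lia.
exists (K + M * k)%N => n.
have := h (k + n)%N; rewrite visitsD mulnDr => hk.
have := visits_le B k w => vk.
have : (M * visits B k w <= M * k)%N by rewrite leq_mul2l vk orbT.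
lia.
Qed.

Lemma measurable_visits B n m : measurable B -> measurable [set w | visits B n w = m].
Proof.
move=> mB.
have -> : [set w | visits B n w = m] = visits B n @^-1` [set m] by [].
apply: (measurable_preimage (f := visits B n)) => //.
elim: n => [|n ih].
  rewrite (_ : visits B 0 = cst 0%N); first exact: measurable_cst.
  by apply/funext => w; exact: tally0.
rewrite (_ : visits B n.+1 = fun w => (visits B n w + `[< B (shift n w) >])%N); last first.
  by apply/funext => w; rewrite /visits /tally big_ord_recr.
apply: measurable_fun_addn => //.
have mb : measurable_fun setT (fun w => `[< B (shift n w) >]).
  apply: (@measurable_fun_bool _ _ _ _ true).
  rewrite setTI (_ : _ @^-1` _ = shift n @^-1` B).
    exact: measurable_preimage (measurable_shift n) mB.
  by apply/seteqP; split=> w /= /asboolP.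
exact: (measurableT_comp (f := nat_of_bool) _ mb).
Qed.

Lemma measurable_linear_visits B M : measurable B -> measurable (linear_visits B M).
Proof.
move=> mB.
rewrite (_ : linear_visits B M = \bigcup_K \bigcap_n \bigcup_(m in [set m | (n <= M * m + K)%N])
    [set w | visits B n w = m]).
  apply: bigcupT_measurable => K; apply: bigcapT_measurable => n.
  by apply: bigcup_measurable => m _; exact: measurable_visits.
apply/seteqP; split=> w.
  by move=> [K h]; exists K => // n _; exists (visits B n w) => //=.
by move=> [K _ h]; exists K => n; have [m /= nm ->] := h n I.
Qed.

Variable pi : probability Z R.
Hypothesis pi_inv : forall C, measurable C -> \int[pi]_z trans_kernel mu q z C = pi C.

Let Pp := mixture_law qd Pz_law (measurable_id (D := setT)) pi.

Let Pp_setT : Pp setT = 1.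
Proof.
rewrite /Pp /mixture_law; under eq_integral do rewrite probability_setT.
by rewrite integral_cst// mul1e; exact: probability_setT.
Qed.

Let mPz A : measurable A -> measurable_fun setT (fun z => Pz z A).
Proof. exact: (measurable_Pz qd Pz_law). Qed.

Let Pp_stationary A : measurable A -> Pp (shift 1 @^-1` A) = Pp A.
Proof.
move=> mA; rewrite /Pp /mixture_law.
have mA1 := measurable_preimage (@measurable_shift _ X N 1) mA.
under eq_integral do rewrite (Pz_step qd Pz_law _ mA1).
rewrite -[RHS](@ge0_integral_mixture _ _ _ _ _ pi setT (ker qd) pi (fun z => Pz z A))//.
- by move=> U mU; exact: measurable_ker.
- exact: mPz.
Qed.

(** The maximum over 0 <= j <= n of j - M * visits B j w; truncated subtraction
    takes the maximum with 0. *)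
Fixpoint excess (B : set path) (M n : nat) (w : path) : nat :=
  if n is n'.+1 then ((excess B M n' (shift 1 w)).+1 - M * `[< B w >])%N else 0%N.

Lemma excess_le B M n w : (excess B M n w <= n)%N.
Proof.
elim: n w => //= n ih w; rewrite leq_subLR (leq_trans _ (leq_addl _ _))// ltnS; exact: ih.
Qed.

Lemma excess_nd B M n w : (excess B M n w <= excess B M n.+1 w)%N.
Proof. by elim: n w => //= n ih w; rewrite leq_sub2r// ltnS; exact: ih. Qed.

Lemma excess_visits B M n w : (n <= excess B M n w + M * visits B n w)%N.
Proof.
elim: n w => //= n ih w; rewrite visitsS mulnDr addnA.
have := ih (shift 1 w); move: (excess _ _ _ _) (M * `[< B w >])%N => e f; lia.
Qed.

Lemma measurable_excess B M n : measurable B -> measurable_fun setT (excess B M n).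
Proof.
move=> mB; elim: n => [|n ih] /=; first exact: measurable_cst.
have mb : measurable_fun setT (fun w : path => `[< B w >]).
  apply: (@measurable_fun_bool _ _ _ _ true).
  by rewrite setTI (_ : _ @^-1` _ = B)//; apply/seteqP; split=> w /= /asboolP.
apply: measurable_fun_subn.
  exact: (measurableT_comp (f := S) _ (measurableT_comp ih (measurable_shift 1))).
exact: (measurableT_comp (f := fun b : bool => (M * b)%N) _ mb).
Qed.

(** Garsia's argument for f = 1 - M * \1_B: where excess n.+1 is positive, it
    equals f plus the shifted excess n. As excess n <= excess n.+1, and as the
    shift preserves the expectation of excess n, the expectation of f over this
    set is nonnegative. *)
Lemma maximal_ergodic_inequality B M : measurable B ->
  M%:R%:E * Pp (B `&` \bigcup_n [set w | (0 < excess B M n w)%N]) <= 1.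
Proof.
move=> mB.
pose G n := [set w | (0 < excess B M n w)%N].
have me n : measurable_fun setT (fun w => (excess B M n w)%:R%:E : \bar R).
  apply/measurable_EFinP.
  exact: (measurableT_comp (f := fun n : nat => n%:R : R) _ (measurable_excess M n mB)).
have mG n : measurable (G n).
  by apply: (measurable_preimage (f := excess B M n) (A := [set k | (0 < k)%N])) => //; exact: measurable_excess.
have mBG n : measurable (B `&` G n) by exact: measurableI.
pose e n := \int[Pp]_w (excess B M n w)%:R%:E.
have e0 n : 0 <= e n by apply: integral_ge0 => w _; rewrite lee_fin.
have efin n : e n \is a fin_num.
  rewrite ge0_fin_numE//; apply: (@le_lt_trans _ _ (\int[Pp]_w (n%:R)%:E)).
    apply: ge0_le_integral => //.
    by move=> w _; rewrite lee_fin ler_nat excess_le.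
  rewrite integral_cst//; rewrite [X in _ * X < _](_ : _ = 1); last exact: Pp_setT.
  by rewrite mule1 ltry.
have GS n : M%:R%:E * Pp (B `&` G n.+1) <= 1.
  have PG1 : Pp (G n.+1) <= 1 by rewrite -Pp_setT measure_mono.
  apply: le_trans PG1.
  have shiftE : \int[Pp]_w (excess B M n (shift 1 w))%:R%:E = e n.
    transitivity (\int[pushforward Pp (@shift _ X N 1)]_w ((excess B M n w)%:R%:E : \bar R)).
      by rewrite ge0_integral_pushforward//; exact: measurable_shift.
    rewrite (@eq_measure_integral _ _ _ _ Pp)//; first exact: measurable_shift.
    by move=> ? A mA _; exact: Pp_stationary.
  have mid (C : set path) : measurable C -> measurable_fun setT (fun w => (\1_C w)%:E : \bar R).
    by move=> mC; apply/measurable_EFinP; exact: measurable_indic.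
  have : e n.+1 + M%:R%:E * Pp (B `&` G n.+1) <= Pp (G n.+1) + e n.
    have I1 (C : set path) : measurable C -> Pp C = \int[Pp]_w (\1_C w)%:E.
      by move=> mC; rewrite integral_indic// setIT.
    rewrite -shiftE (I1 _ (mBG _)) (I1 _ (mG _)).
    have ms : measurable_fun setT (fun w => (excess B M n (shift 1 w))%:R%:E : \bar R).
      exact: (measurableT_comp (me n) (measurable_shift 1)).
    have mM : measurable_fun setT (fun w => M%:R%:E * (\1_(B `&` G n.+1) w)%:E : \bar R).
      by apply: measurable_funeM; exact: mid.
    have fin0 (f : path -> R) : (forall w, 0 <= f w)%R -> forall w, setT w -> 0 <= (f w)%:E.
      by move=> f0 w _; rewrite lee_fin.
    have M0 w : [set: path] w -> 0 <= M%:R%:E * (\1_(B `&` G n.+1) w)%:E :> \bar R.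
      by move=> _; rewrite mule_ge0 ?lee_fin.
    rewrite -(ge0_integralZl_EFin Pp measurableT (fin0 _ _) (mid _ (mBG n.+1)))//.
    rewrite -(ge0_integralD Pp measurableT (fin0 _ _) (me n.+1) M0 mM)//.
    rewrite -(ge0_integralD Pp measurableT (fin0 _ _) (mid _ (mG n.+1)) (fin0 _ _) ms)//.
    apply: ge0_le_integral => //.
    - by move=> w wT; rewrite adde_ge0 ?lee_fin//; exact: M0.
    - by apply: emeasurable_funD.
    - by apply: emeasurable_funD => //; exact: mid.
    (* pointwise, this is the recursion for the excess on G n.+1 *)
    - move=> w _; rewrite -EFinM -!EFinD lee_fin !indicE -natrM -!natrD ler_nat.
      have -> : (w \in B `&` G n.+1) = `[< B w >] && (0 < excess B M n.+1 w)%N.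
        by apply/idP/andP => [/set_mem[/asboolP ? ?]//|[/asboolP ? ?]]; exact: mem_set.
      have -> : (w \in G n.+1) = (0 < excess B M n.+1 w)%N.
        by apply/idP/idP => [/set_mem//|?]; exact: mem_set.
      rewrite [excess _ _ n.+1 _]/=.
      case: `[< B w >] => /=; rewrite ?muln1 ?muln0/=; last by lia.
      by case: ltnP; lia.
  have : e n <= e n.+1.
    apply: ge0_le_integral => //.
    by move=> w _; rewrite lee_fin ler_nat excess_nd.
  have PBfin : Pp (B `&` G n.+1) \is a fin_num.
    by rewrite ge0_fin_numE// (@le_lt_trans _ _ 1) ?ltry// -Pp_setT measure_mono.
  have PGfin : Pp (G n.+1) \is a fin_num.
    by rewrite ge0_fin_numE// (@le_lt_trans _ _ 1) ?ltry// -Pp_setT measure_mono.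
  move: PBfin PGfin (efin n) (efin n.+1) => /fineK<- /fineK<- /fineK<- /fineK<-.
  by rewrite -EFinM -!EFinD !lee_fin; lra.
have GS' n : M%:R%:E * Pp (B `&` G n) <= 1.
  apply: le_trans (GS n); apply: lee_wpmul2l; first by rewrite lee_fin.
  apply: measure_mono => //; apply: setIS => w; rewrite /G/= => h.
  exact: leq_trans h (excess_nd _ _ _ _).
have ndG : nondecreasing_seq (fun n => B `&` G n).
  apply/nondecreasing_seqP => n; apply/subsetPset; apply: setIS => w; rewrite /G/= => h.
  exact: leq_trans h (excess_nd _ _ _ _).
rewrite setI_bigcupr.
have mU : measurable (\bigcup_n (B `&` G n)) by exact: bigcupT_measurable.
have cv := nondecreasing_cvg_mu (mu := Pp) mBG mU ndG.
have cv2 : M%:R%:E * Pp (B `&` G n) @[n --> \oo] --> M%:R%:E * Pp (\bigcup_n (B `&` G n)).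
  by apply: cvgeZl => //; exact: cv.
rewrite -(cvg_lim _ cv2)//; apply: lime_le; first by apply/cvg_ex; eexists; exact: cv2.
by exists 0%N => // n _; exact: GS'.
Qed.

Variable psi : {sigma_finite_measure set Z -> \bar R}.
Hypothesis psiT : 0 < psi setT.
Hypothesis Z_harris : harris_recurrent Pz psi.

(** For M large, the maximal inequality shows that linear_visits B M has positive
    probability under the stationary law. This event L is shift invariant, hence
    so is its complement, and one of the sets where P_z L >= 1/2 or
    P_z (~` L) >= 1/2 has positive psi measure: by Harris recurrence, either
    P_z L = 1 for all z or P_z L = 0 for all z. *)
Lemma linear_growth B : measurable B -> (forall z, Pz z (io B) = 1) ->
  exists M, forall z, Pz z (linear_visits B M) = 1.
Proof.
move=> mB ioB.
have PB0 : 0 < Pp B.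
  rewrite lt0e measure_ge0 andbT; apply/eqP => PB.
  have Pk k : Pp (shift k @^-1` B) = 0.
    elim: k => [|k ih].
      rewrite (_ : _ @^-1` _ = B)//; apply/seteqP; split=> w //=.
    rewrite -ih -[RHS]Pp_stationary; last exact: measurable_preimage (measurable_shift k) mB.
    by congr Pp; apply/seteqP; split=> w /=; rewrite shiftD.
  have mk k : measurable (shift k @^-1` B) by exact: measurable_preimage (measurable_shift k) mB.
  have : Pp (\bigcup_k (shift k @^-1` B)) = 1.
    apply/eqP; rewrite eq_le; apply/andP; split.
      by rewrite -Pp_setT measure_mono//; exact: bigcupT_measurable.
    have <- : Pp (io B) = 1.
      rewrite /Pp /mixture_law; under eq_integral do rewrite ioB.
      by rewrite integral_cst// mul1e; exact: probability_setT.
    apply: measure_mono; [exact: measurable_io|exact: bigcupT_measurable|].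
    by move=> w h; have [k _ Bk] := h 0%N; exists k.
  have : Pp (\bigcup_k (shift k @^-1` B)) <= \sum_(k <oo) Pp (shift k @^-1` B).
    apply: measure_sigma_subadditive => //; exact: bigcupT_measurable.
  rewrite eseries0 => [|i _ _]; last exact: Pk.
  by move=> + E; rewrite E lee_fin ler10.
have PBfin : Pp B \is a fin_num.
  by rewrite ge0_fin_numE// (@le_lt_trans _ _ 1) ?ltry// -Pp_setT measure_mono.
(* 1 - M * \1_B then has negative expectation under the stationary law *)
have [M hM] : exists M : nat, 1 < M%:R%:E * Pp B.
  have p0 : (0 < fine (Pp B))%R by rewrite fine_gt0// PB0 -ge0_fin_numE.
  exists (Num.truncn (fine (Pp B))^-1).+1.
  by rewrite -(fineK PBfin) -EFinM lte_fin -ltr_pdivrMr// mul1r truncnS_gt.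
exists M.
pose L := linear_visits B M.
have mL : measurable L by exact: measurable_linear_visits.
have mLC : measurable (~` L) by exact: measurableC.
have half0 : (0 < 2^-1 :> R)%R by rewrite invr_gt0.
pose D1 := [set z | (2^-1)%:E <= Pz z L].
pose D2 := [set z | (2^-1)%:E <= Pz z (~` L)].
have mD1 : measurable D1.
  by rewrite -[D1]setTI; apply: emeasurable_fun_c_infty => //; exact: mPz.
have mD2 : measurable D2.
  by rewrite -[D2]setTI; apply: emeasurable_fun_c_infty => //; exact: mPz.
have D12 : setT `<=` D1 `|` D2.
  move=> z _; have [|h] := leP (2^-1)%:E (Pz z L); first by left.
  right; rewrite /D2/= probability_setC//.
  move: h; have /fineK <- : Pz z L \is a fin_num by exact: fin_num_measure.
  by rewrite -EFinB lte_fin lee_fin; lra.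
have [p1|p1] := ltP 0 (psi D1).
  move=> z; apply/eqP; rewrite eq_le probability_le1//=.
  rewrite -(harris_io qd Pz_law Z_harris mD1 mL p1 half0 (fun z h => h) z).
  apply: measure_mono => //; first exact: measurable_io.
  by move=> w h; have [k _ /linear_visits_shift] := h 0%N.
have p2 : 0 < psi D2.
  rewrite (lt_le_trans psiT)//.
  apply: (le_trans (measure_mono psi measurableT (measurableU _ _ mD1 mD2) D12)).
  apply: (le_trans (measureU2 _ mD1 mD2)).
  by rewrite -[leRHS]add0e leeD.
have PzL z : Pz z L = 0.
  have : Pz z (~` L) = 1.
    apply/eqP; rewrite eq_le probability_le1//=.
    rewrite -(harris_io qd Pz_law Z_harris mD2 mLC p2 half0 (fun z h => h) z).
    apply: measure_mono => //; first exact: measurable_io.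
    by move=> w h; have [k _ + Lw] := h 0%N; apply; apply/linear_visits_shift.
  rewrite probability_setC//.
  have /fineK <- : Pz z L \is a fin_num by exact: fin_num_measure.
  by move=> /eqP; rewrite -EFinB eqe => /eqP h; congr EFin; lra.
exfalso.
pose G := \bigcup_n [set w | (0 < excess B M n w)%N].
have mG : measurable G.
  apply: bigcupT_measurable => n.
  by apply: (measurable_preimage (f := excess B M n) (A := [set k | (0 < k)%N])) => //; exact: measurable_excess.
have GL : ~` G `<=` L.
  move=> w nG; exists 0%N => n; rewrite addn0.
  have := excess_visits B M n w; suff -> : excess B M n w = 0%N by [].
  by apply/eqP; rewrite -leqn0 leqNgt; apply/negP => h; apply: nG; exists n.
have PL : Pp L = 0.
  by rewrite /Pp /mixture_law; under eq_integral do rewrite PzL; rewrite integral0.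
have := maximal_ergodic_inequality M mB; rewrite leNgt => /negP; apply.
apply: (lt_le_trans hM); apply: lee_wpmul2l; first by rewrite lee_fin.
have mBG : measurable (B `&` G) by exact: measurableI.
have mBGC : measurable (B `&` ~` G) by apply: measurableI => //; exact: measurableC.
have BG0 : Pp (B `&` ~` G) <= 0.
  by rewrite -PL; apply: measure_mono => // w [_ /GL].
apply: (@le_trans _ _ (Pp (B `&` G) + Pp (B `&` ~` G))).
  by rewrite -[X in Pp X <= _](setIT B) -(setUv G) setIUr; exact: measureU2.
by rewrite -[leRHS]adde0; exact: leeD.
Qed.

End linear_growth.

(** * Contraction of brackets *)
Section bracketing.
Context (R : realType) (I : finType).

(** All ratios g i / b i lie in an interval of length at most D; products avoid
    the indices where b vanishes. *)
Definition bracketed (D : R) (b g : I -> R) : Prop :=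
  exists lo hi, [/\ 0 <= lo, lo <= hi, hi <= 1, hi - lo <= D &
    forall i, lo * b i <= g i <= hi * b i].

Lemma bracketed_le D D' b g : D <= D' -> bracketed D b g -> bracketed D' b g.
Proof.
move=> DD' [lo [hi [lo0 lh hi1 lohi h]]]; exists lo, hi; split => //.
exact: le_trans DD'.
Qed.

Lemma bracketed1 b g : (forall i, 0 <= g i <= b i) -> bracketed 1 b g.
Proof.
move=> h; exists 0, 1; split; rewrite ?subr0 ?ler01// => i.
by rewrite mul0r mul1r.
Qed.

Lemma bracketed_kernel D b g (w : I -> I -> R) : (forall i j, 0 <= w i j) ->
  bracketed D b g ->
  bracketed D (fun i => \sum_j w i j * b j) (fun i => \sum_j w i j * g j).
Proof.
move=> w0 [lo [hi [lo0 lh hi1 lohi h]]]; exists lo, hi; split => // i.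
rewrite !mulr_sumr; apply/andP; split; apply: ler_sum => j _;
  by rewrite mulrCA ler_wpM2l//; have /andP[] := h j.
Qed.

(** For i in A, the weights w i j * b j on B, once normalized, are at least e ^+ 2
    times the normalized weights b j, because the entries w i j lie in
    [e, e^-1]. So all new ratios share a fraction e ^+ 2 of the common value m,
    the mean ratio over B. *)
Lemma bracketed_doeblin D b g (w : I -> I -> R) (A B : {set I}) (e : R) :
  0 < e < 1 -> (forall i, 0 <= b i) ->
  (forall i j, i \in A -> j \in B -> e <= w i j <= e^-1) ->
  (forall i j, ~~ ((i \in A) && (j \in B)) -> w i j = 0) ->
  bracketed D b g ->
  bracketed ((1 - e ^+ 2) * D) (fun i => \sum_j w i j * b j)
                               (fun i => \sum_j w i j * g j).
Proof.
move=> /andP[e0 e1] b0 wAB w0 [lo [hi [lo0 lh hi1 lohi h]]].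
have e20 : 0 < e ^+ 2 by rewrite exprn_gt0.
have e21 : e ^+ 2 < 1 by rewrite exprn_ilt1// ltW.
pose sb := \sum_(j in B) b j; pose sg := \sum_(j in B) g j.
have sb0 : 0 <= sb by apply: sumr_ge0.
have g0 j : 0 <= g j.
  by have /andP[+ _] := h j; apply: le_trans; rewrite mulr_ge0.
have sumB i (f : I -> R) : \sum_j w i j * f j = \sum_(j in B) w i j * f j.
  rewrite (bigID (mem B))/= [X in _ + X]big1 ?addr0// => j jB.
  by rewrite w0 ?mul0r// negb_and jB orbT.
have sumA i (f : I -> R) : i \notin A -> \sum_j w i j * f j = 0.
  by move=> iA; rewrite big1// => j _; rewrite w0 ?mul0r// negb_and iA.
have losg : lo * sb <= sg.
  by rewrite mulr_sumr; apply: ler_sum => j _; have /andP[] := h j.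
have hisg : sg <= hi * sb.
  by rewrite mulr_sumr; apply: ler_sum => j _; have /andP[] := h j.
(* when sb = 0, all new values vanish and any bracket is good *)
have [sbp|] := ltP 0 sb; last first.
  move=> sbn; have sbE : sb = 0 by apply/eqP; rewrite eq_le sbn.
  have bB j : j \in B -> b j = 0.
    move=> jB; apply/eqP; move/eqP: sbE; rewrite psumr_eq0// => /allP/(_ j (mem_index_enum _)).
    by rewrite jB.
  have gB j : j \in B -> g j = 0.
    by move=> jB; have := h j; rewrite bB// !mulr0 -eq_le => /eqP.
  exists lo, lo; split => //; first exact: le_trans hi1.
    by rewrite subrr; apply: mulr_ge0; [rewrite subr_ge0 ltW|apply: le_trans lohi; rewrite subr_ge0].
  move=> i; rewrite !sumB !big1 ?mulr0 ?lexx// => j jB; first by rewrite gB ?mulr0.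
  by rewrite bB ?mulr0.
pose m := sg / sb.
have lom : lo <= m by rewrite ler_pdivlMr.
have mhi : m <= hi by rewrite ler_pdivrMr.
exists (lo + e ^+ 2 * (m - lo)), (hi - e ^+ 2 * (hi - m)); split.
- by rewrite addr_ge0// mulr_ge0 ?subr_ge0// ltW.
- have : (1 - e ^+ 2) * (hi - lo) >= 0 by rewrite mulr_ge0 ?subr_ge0// ltW.
  by rewrite !(mulrBl, mulrBr) mul1r; lra.
- by rewrite (le_trans _ hi1)// gerBl mulr_ge0 ?subr_ge0// ltW.
- rewrite (_ : _ - _ = (1 - e ^+ 2) * (hi - lo)); last by ring.
  by rewrite ler_wpM2l// subr_ge0 ltW.
move=> i; have [iA|iA] := boolP (i \in A); last by rewrite !sumA// !mulr0 lexx.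
rewrite !sumB.
have wb : \sum_(j in B) w i j * b j <= e^-1 * sb.
  by rewrite mulr_sumr; apply: ler_sum => j jB; rewrite ler_wpM2r//; have /andP[] := wAB i j iA jB.
have wb0 : 0 <= \sum_(j in B) w i j * b j.
  apply: sumr_ge0 => j jB; rewrite mulr_ge0//.
  by have /andP[+ _] := wAB i j iA jB; apply: le_trans; rewrite ltW.
have E1 : e * (sg - lo * sb) <= \sum_(j in B) w i j * g j - lo * \sum_(j in B) w i j * b j.
  rewrite !mulr_sumr -!sumrB mulr_sumr; apply: ler_sum => j jB.
  rewrite (mulrCA lo) -mulrBr; apply: ler_wpM2r.
    by rewrite subr_ge0; have /andP[] := h j.
  by have /andP[] := wAB i j iA jB.
have E2 : e * (hi * sb - sg) <= hi * (\sum_(j in B) w i j * b j) - \sum_(j in B) w i j * g j.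
  rewrite !mulr_sumr -!sumrB mulr_sumr; apply: ler_sum => j jB.
  rewrite (mulrCA hi) -mulrBr; apply: ler_wpM2r.
    by rewrite subr_ge0; have /andP[] := h j.
  by have /andP[] := wAB i j iA jB.
have msb : sg = m * sb by rewrite /m divfK// gt_eqF.
have key (u : R) : 0 <= u -> e ^+ 2 * u * (\sum_(j in B) w i j * b j) <= e * (u * sb).
  move=> u0; rewrite (_ : e * (u * sb) = e ^+ 2 * u * (e^-1 * sb)).
    by rewrite ler_wpM2l// mulr_ge0// ltW.
  by field; rewrite gt_eqF.
have k1 := key (m - lo); have k2 := key (hi - m).
rewrite subr_ge0 in k1; rewrite subr_ge0 in k2.
move: (k1 lom) (k2 mhi) E1 E2; rewrite msb; move: (\sum_(j in B) _) (\sum_(j in B) _) => x y.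
by rewrite !(mulrDl, mulrBl); lra.
Qed.

(** Bernoulli's inequality for theta = 1 - (1 - rho) / n.+1. *)
Lemma root_lower_bound (rho : R) n : 0 < rho < 1 ->
  exists2 theta : R, 0 < theta < 1 & rho <= theta ^+ n.
Proof.
move=> /andP[r0 r1].
pose u := (1 - rho) / n.+1%:R.
have n0 : 0 < n.+1%:R :> R by rewrite ltr0n.
have u0 : 0 < u by rewrite divr_gt0// subr_gt0.
have nu : n.+1%:R * u = 1 - rho by rewrite mulrC divfK// gt_eqF.
have un : u <= 1 - rho.
  by rewrite -nu ler_peMl ?ler1n// ltW.
have bern k : 1 - k%:R * u <= (1 - u) ^+ k.
  elim: k => [|k ih]; first by rewrite mul0r subr0 expr0.
  rewrite exprS; apply: (@le_trans _ _ ((1 - u) * (1 - k%:R * u))).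
    rewrite -natr1; have : 0 <= k%:R * u * u by apply: mulr_ge0 (ltW u0); apply: mulr_ge0 (ltW u0).
    by move: (k%:R) => v; rewrite !(mulrDl, mulrBl, mulrBr, mul1r, mulr1); lra.
  by rewrite ler_wpM2l//; lra.
exists (1 - u); first by apply/andP; split; lra.
apply: le_trans (bern n).
have : n%:R * u <= n.+1%:R * u by rewrite ler_wpM2r ?ler_nat// ltW.
by rewrite nu; lra.
Qed.

End bracketing.

(** * Windows of observations and backward recursions *)
Section blocks.
Context d (X : measurableType d) (N : nat) (R : realType).
Local Notation Y := 'I_N.+1.
Local Notation Z := (X * Y)%type.
Variable q : Z -> Z -> R.
Hypothesis q0 : forall z' z, 0 <= q z' z.

Definition sdrop (S : Type) k (x : nat -> S) : nat -> S := fun i => x (k + i)%N.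

(** [path_weight] along a sequence, by recursion on the first step. *)
Fixpoint weight k (x : nat -> X) (i j : Y) : R :=
  if k is k'.+1 then
    \sum_l q (x 1%N, l) (x 0%N, i) * weight k' (sdrop 1 x) l j
  else (i == j)%:R.

Definition window r (x : nat -> X) : r.-tuple X := [tuple x k | k < r].

Lemma nth_window r x k : (k < r)%N -> nth point (window r x) k = x k.
Proof. by move=> kr; rewrite -(tnth_nth _ _ (Ordinal kr)) tnth_mktuple. Qed.

Lemma windowS r (x : nat -> X) :
  window r.+1 x = [tuple of x 0%N :: window r (sdrop 1 x)].
Proof.
apply: eq_from_tnth => k; rewrite tnth_mktuple.
have [->|k0] := eqVneq k ord0; first by rewrite tnth0.
have [k' ->] : exists k' : 'I_r, k = lift ord0 k'.
  by case: (unliftP ord0 k) k0 => [k' -> _|->]; [exists k'|rewrite eqxx].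
by rewrite tnthS tnth_mktuple.
Qed.

Lemma sum_tupleS n (F : n.+1.-tuple Y -> R) :
  \sum_y F y = \sum_i \sum_(y : n.-tuple Y) F [tuple of i :: y].
Proof.
rewrite pair_big/= (reindex (fun p : Y * n.-tuple Y => [tuple of p.1 :: p.2]))//=.
exists (fun y => (thead y, [tuple of behead y])).
  by move=> [i y] _ /=; congr (_, _); apply: val_inj.
by move=> y _; apply: val_inj => /=; rewrite [in RHS](tuple_eta y).
Qed.

Lemma weight_pathE k x i j :
  weight k x i j = \sum_(y : k.+1.-tuple Y)
    ((nth point y 0 == i) && (nth point y k == j))%:R *
    \prod_(1 <= l < k.+1) q (x l, nth point y l) (x l.-1, nth point y l.-1).
Proof.
elim: k x i => [|k ih] x i /=.
  rewrite sum_tupleS (bigD1 i)//= (bigD1 [tuple])//= big_geq// mulr1 eqxx/=.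
  rewrite [X in _ = _ + X + _]big1 ?addr0; last first.
    by move=> y /negP[]; rewrite [y]tuple0.
  rewrite big1 ?addr0// => l il; rewrite big1// => y _.
  by rewrite (negbTE il) mul0r.
rewrite [RHS]sum_tupleS [RHS](bigD1 i)//= [X in _ = _ + X]big1 ?addr0; last first.
  by move=> l il; rewrite big1// => y _; rewrite (negbTE il) mul0r.
under eq_bigr do rewrite ih mulr_sumr.
rewrite exchange_big/=; apply: eq_bigr => y _.
rewrite (bigD1 (nth point y 0))//= [X in _ + X]big1 ?addr0; last first.
  by move=> l ly; rewrite [_ == l]eq_sym (negbTE ly) mul0r mulr0.
rewrite !eqxx/= [in RHS]big_ltn//= mulrCA; congr (_ * _).
congr (_ * _); rewrite [RHS]big_add1/=; apply: eq_big_nat => l /andP[l1 lk].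
by rewrite /sdrop !add1n; case: l l1 lk.
Qed.

Lemma path_weight_window r x i j : path_weight q (window r.+1 x) i j = weight r x i j.
Proof.
rewrite weight_pathE /path_weight [LHS]big_mkcond/=; apply: eq_bigr => y _.
case: ifP => _; rewrite ?mul0r// mul1r.
apply: eq_big_nat => l /andP[l1 lr]; rewrite !nth_window//.
by rewrite (leq_ltn_trans (leq_pred _)).
Qed.

Lemma path_weight_ge0 n (x : n.-tuple X) i j : 0 <= path_weight q x i j.
Proof. by apply: sumr_ge0 => y _; apply: prodr_ge0. Qed.

Lemma weight_ge0 k x i j : 0 <= weight k x i j.
Proof. by rewrite -path_weight_window path_weight_ge0. Qed.

(** The recursion, in the number t of steps to come, of the likelihoods of the
    observations x_1, x_2, ... given the initial state (x_0, i). *)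
Definition backward (h : nat -> (nat -> X) -> Y -> R) : Prop :=
  forall t x i, h t.+1 x i = \sum_j q (x 1%N, j) (x 0%N, i) * h t (sdrop 1 x) j.

Lemma backward_weight h k t x i : backward h ->
  h (k + t)%N x i = \sum_j weight k x i j * h t (sdrop k x) j.
Proof.
move=> hr; elim: k x i => [|k ih] x i /=.
  rewrite (bigD1 i)//= eqxx mul1r big1 ?addr0// => j ji.
  by rewrite eq_sym (negbTE ji) mul0r.
transitivity (\sum_l \sum_j q (x 1%N, l) (x 0%N, i) *
    (weight k (sdrop 1 x) l j * h t (sdrop k (sdrop 1 x)) j)).
  by rewrite addSn hr; apply: eq_bigr => l _; rewrite ih mulr_sumr.
rewrite exchange_big/=; apply: eq_bigr => j _; rewrite mulr_suml.
by apply: eq_bigr => l _; rewrite mulrA.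
Qed.

Variables (r : nat) (E : set (r.-tuple X)) (Yp : {set Y * Y}).
Hypothesis A1 : condA1 q E Yp.

(** One parameter for both bounds: these sets, for e = 1/2, 1/3, ..., cover E. *)
Definition bounded_part (e : R) : set (r.-tuple X) :=
  [set x | E x /\ forall i j, (i, j) \in Yp -> e <= path_weight q x i j <= e^-1].

(** Good windows may overlap, so that their factors 1 - e ^+ 2 cannot all be
    collected. Instead theta is charged for every good start: jumping over a good
    window gains 1 - e ^+ 2 <= theta ^+ r and skips r.-1 starts. The denominator
    theta ^+ r accounts for the windows that exceed the horizon t. *)
Lemma bracketed_backward (e theta : R) (b g : nat -> (nat -> X) -> Y -> R) t x :
  0 < e < 1 -> 0 < theta < 1 -> 1 - e ^+ 2 <= theta ^+ r ->
  backward b -> backward g -> (forall x i, 0 <= g 0%N x i <= b 0%N x i) ->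
  bracketed (theta ^+ tally (fun k => `[< bounded_part e (window r (sdrop k x)) >]) t
               / theta ^+ r) (b t x) (g t x).
Proof.
move=> e01 /andP[th0 th1] et hb hg gb0.
have [r1 _ _ EYp YpX] := A1.
have gb s y i : 0 <= g s y i <= b s y i.
  elim: s y i => [|s ih] y i; first exact: gb0.
  rewrite hb hg; apply/andP; split.
    by apply: sumr_ge0 => j _; apply: mulr_ge0 => //; have /andP[] := ih (sdrop 1 y) j.
  by apply: ler_sum => j _; rewrite ler_wpM2l//; have /andP[] := ih (sdrop 1 y) j.
have b0 s y i : 0 <= b s y i by have /andP[/le_trans + /[dup] ? H] := gb s y i; apply.
have thr0 : 0 < theta ^+ r by rewrite exprn_gt0.
have small s y : (tally (fun k => `[< bounded_part e (window r (sdrop k y)) >]) s <= r)%N ->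
  bracketed (theta ^+ tally (fun k => `[< bounded_part e (window r (sdrop k y)) >]) s
               / theta ^+ r) (b s y) (g s y).
  move=> sr; apply: bracketed_le (bracketed1 (gb s y)).
  by rewrite ler_pdivlMr// mul1r; apply: ler_wiXn2l => //; exact: ltW.
elim/ltn_ind: t x => -[|t] ih x; first by apply: small; rewrite tally0.
have [Ex|nEx] := boolP `[< bounded_part e (window r x) >]; last first.
  rewrite tallyS.
  have -> : sdrop 0 x = x by [].
  rewrite (negbTE nEx) add0n.
  have := ih t (ltnSn t) (sdrop 1 x).
  move/(bracketed_kernel (w := fun i j => q (x 1%N, j) (x 0%N, i))) => /(_ (fun i j => q0 _ _)).
  by rewrite -(funext (hb t x)) -(funext (hg t x)).
have [tr|rt] := leqP t.+1 r.-1.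
  apply: small; apply: (leq_trans (tally_le _ _)).
  by apply: (leq_trans tr); exact: leq_pred.
pose t1 := (t.+1 - r.-1)%N.
have tE : (r.-1 + t1 = t.+1)%N by rewrite subnKC// ltnW.
have r0 : (0 < r.-1)%N by rewrite -ltnS prednK// ltnW.
have t1t : (t1 < t.+1)%N by rewrite /t1 ltn_subrL r0.
have /asboolP[Ew wE] := Ex.
have := ih t1 t1t (sdrop r.-1 x).
set D := (X in bracketed X) => hD.
have rE : r.-1.+1 = r by rewrite prednK// ltnW.
have wpw i j : weight r.-1 x i j = path_weight q (window r x) i j.
  by rewrite -path_weight_window; move: (window) => W; rewrite rE.
have := @bracketed_doeblin R Y D _ _ (weight r.-1 x)
   [set ij.1 | ij in Yp]%SET [set ij.2 | ij in Yp]%SET e e01 (b0 t1 (sdrop r.-1 x)).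
have wAB i j : i \in [set ij.1 | ij in Yp]%SET -> j \in [set ij.2 | ij in Yp]%SET ->
    e <= weight r.-1 x i j <= e^-1.
  by move=> iA jB; rewrite wpw; apply: wE; rewrite YpX finset.in_setX iA.
have w0 i j : ~~ ((i \in [set ij.1 | ij in Yp]%SET) && (j \in [set ij.2 | ij in Yp]%SET)) ->
    weight r.-1 x i j = 0.
  move=> nij; apply/eqP; rewrite eq_le weight_ge0 andbT leNgt wpw.
  apply: contra nij => pw; have : (i, j) \in Yp by rewrite -(EYp _ Ew) finset.inE.
  by rewrite {1}YpX finset.in_setX.
move=> /(_ _ wAB w0 hD).
rewrite -tE -(funext (fun i => backward_weight r.-1 t1 x i hb)).
rewrite -(funext (fun i => backward_weight r.-1 t1 x i hg)).
apply: bracketed_le; rewrite /D mulrA ler_pM2r ?invr_gt0//.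
rewrite tallyD.
set c := tally _ t1; set c' := tally _ t1.
have -> : c' = c.
  by congr tally; apply/funext => k; congr (`[< bounded_part e (window r _) >]);
     apply/funext => i; rewrite /sdrop addnA.
apply: (@le_trans _ _ (theta ^+ r * theta ^+ c)).
  by rewrite ler_pM2r// exprn_gt0.
rewrite -exprD; apply: ler_wiXn2l; [exact: ltW|exact: ltW|].
rewrite leq_add2r; apply: (leq_trans (tally_le _ _)); exact: leq_pred.
Qed.

End blocks.

(** * Likelihoods of observations and hidden events *)
Section likelihood.
Context d (X : measurableType d) (N : nat) (R : realType).
Variable mu : {sigma_finite_measure set X -> \bar R}.
Local Notation Y := 'I_N.+1.
Local Notation Z := (X * Y)%type.
Local Notation path := (path_space X N).
Variable q : Z -> Z -> R.
Hypothesis qd : transition_density mu q.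
Variable Pz : Z -> probability path R.
Hypothesis Pz_law : forall z, law_from mu q z (Pz z).

Let q0 z' z : 0 <= q z' z. Proof. by case: qd. Qed.

Definition obs (w : path) : nat -> X := fun k => (w k).1.
Definition hidden (w : path) : nat -> Y := fun k => (w k).2.

Definition ycons (i : Y) (y : nat -> Y) : nat -> Y :=
  fun k => if k is k'.+1 then y k' else i.

Lemma hidden_cons z w : hidden (path_cons z w) = ycons z.2 (hidden w).
Proof. by apply/funext => -[]. Qed.

Definition hidden_event (a : set (nat -> Y)) : set path := [set w | a (hidden w)].

Definition measurable_hidden (a : set (nat -> Y)) := measurable (hidden_event a).

Definition after (i : Y) (a : set (nat -> Y)) : set (nat -> Y) := [set y | a (ycons i y)].

Lemma hidden_event_cons z a :
  path_cons z @^-1` hidden_event a = hidden_event (after z.2 a).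
Proof. by apply/seteqP; split=> w; rewrite /hidden_event/= hidden_cons. Qed.

Lemma measurable_hidden_after i a : measurable_hidden a -> measurable_hidden (after i a).
Proof.
move=> ma; rewrite /measurable_hidden -(hidden_event_cons (point, i)).
exact: measurable_preimage (measurable_path_cons _) ma.
Qed.

(** Likelihood of x_1, ..., x_n and of the hidden event a, given the initial
    state (x_0, i). The event may concern hidden states beyond time n, whence the
    probability P_z at the last observation. *)
Fixpoint lik n (a : set (nat -> Y)) (x : nat -> X) (i : Y) : R :=
  if n is n'.+1 then
    \sum_j q (x 1%N, j) (x 0%N, i) * lik n' (after i a) (sdrop 1 x) j
  else fine (Pz (x 0%N, i) (hidden_event a)).

Lemma lik_ge0 n a x i : 0 <= lik n a x i.
Proof.
elim: n a x i => [|n ih] a x i /=; first by rewrite fine_ge0.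
by apply: sumr_ge0 => j _; rewrite mulr_ge0.
Qed.

Let Pz_fin z A : measurable A -> Pz z A \is a fin_num.
Proof. by move=> mA; exact: fin_num_measure. Qed.

Lemma lik_le n a a' x i : measurable_hidden a -> measurable_hidden a' -> a `<=` a' ->
  lik n a x i <= lik n a' x i.
Proof.
elim: n a a' x i => [|n ih] a a' x i ma ma' aa' /=.
  apply: fine_le; [exact: Pz_fin|exact: Pz_fin|apply: measure_mono => //].
  by move=> w /aa'.
apply: ler_sum => j _; apply: ler_wpM2l => //; apply: ih => //.
- exact: measurable_hidden_after.
- exact: measurable_hidden_after.
- by move=> y /aa'.
Qed.

Lemma lik_setC n a x i : measurable_hidden a ->
  lik n (~` a) x i = lik n setT x i - lik n a x i.
Proof.
elim: n a x i => [|n ih] a x i ma /=.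
  have -> : hidden_event (~` a) = ~` hidden_event a by [].
  have -> : hidden_event setT = setT by [].
  rewrite probability_setC// probability_setT/= fineB//; exact: Pz_fin.
rewrite -sumrB; apply: eq_bigr => j _; rewrite -mulrBr -ih//.
exact: measurable_hidden_after.
Qed.

Lemma eq_lik n a x x' i : (forall k, (k <= n)%N -> x k = x' k) -> lik n a x i = lik n a x' i.
Proof.
elim: n a x x' i => [|n ih] a x x' i xx' /=; first by rewrite xx'.
rewrite !xx'//; apply: eq_bigr => j _; congr (_ * _).
by apply: ih => k kn; apply: xx'.
Qed.

Lemma measurable_lik d1 (T1 : measurableType d1) n a (V : nat -> T1 -> X) i :
  (forall k, (k <= n)%N -> measurable_fun setT (V k)) -> measurable_hidden a ->
  measurable_fun setT (fun t => lik n a (fun k => V k t) i).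
Proof.
elim: n a V i => [|n ih] a V i mV ma /=.
  apply: (measurableT_comp (f := fine)); first exact: fine_measurable.
  apply: (measurableT_comp (measurable_Pz qd Pz_law ma)).
  by apply: measurable_fun_pair => //; exact: mV.
apply: measurable_sum => j; apply: measurable_funM.
  by apply: (measurable_q qd); apply: measurable_fun_pair => //; exact: mV.
apply: (ih _ (fun k => V (1 + k)%N)); first by move=> k kn; exact: mV.
exact: measurable_hidden_after.
Qed.

Definition obs_determined n (B : set path) : Prop :=
  forall w w', (forall k, (k < n)%N -> obs w k = obs w' k) -> B w -> B w'.

Lemma obs_determinedE n B : obs_determined n B -> determined n B.
Proof. by move=> dB w w' ww'; apply: dB => k kn; rewrite /obs ww'. Qed.

(** The density in the first observation of the event B from the state z. *)
Definition step_density (B : set path) z x : \bar R :=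
  (\sum_j ((q (x, j) z)%:E * Pz (x, j) (path_cons z @^-1` B)))%E.

Let mpair (j : Y) : measurable_fun setT (fun x : X => (x, j)).
Proof. by apply: measurable_fun_pair; [exact: measurable_id|exact: measurable_cst]. Qed.

Lemma measurable_step_density B z : measurable B -> measurable_fun setT (step_density B z).
Proof.
move=> mB; apply: emeasurable_sum => j; apply: emeasurable_funM.
  apply/measurable_EFinP; apply: (measurable_q qd); first exact: mpair.
  exact: measurable_cst.
have mc := measurable_preimage (measurable_path_cons z) mB.
exact: (measurableT_comp (measurable_Pz qd Pz_law mc) (mpair j)).
Qed.

Lemma step_density_ge0 B z x : (0 <= step_density B z x)%E.
Proof. by apply: sume_ge0 => j _; rewrite mule_ge0 ?lee_fin. Qed.

Lemma Pz_density z B : measurable B -> (Pz z B = \int[mu]_x step_density B z x)%E.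
Proof.
move=> mB; rewrite (Pz_step qd Pz_law z mB) integral_ker//.
by apply: (measurable_Pz qd Pz_law); exact: measurable_preimage (measurable_path_cons z) mB.
Qed.

(** Integrating the hypothesis over x_1, ..., x_n. It holds only after summation
    over hidden states, and one step of the chain replaces each hidden state by
    all its successors with new weights; hence the induction runs over finite
    weighted families. *)
Lemma lik_lower_bound n (I : finType) (c : I -> R) (y : I -> Y)
    (a : I -> set (nat -> Y)) x (B : set path) (la : R) :
  (forall i, 0 <= c i) -> 0 <= la -> (forall i, measurable_hidden (a i)) ->
  measurable B -> obs_determined n.+1 B ->
  (forall w, B w -> obs w 0%N = x ->
    la * (\sum_i c i * lik n setT (obs w) (y i)) <= \sum_i c i * lik n (a i) (obs w) (y i)) ->
  (la%:E * \sum_i (c i)%:E * Pz (x, y i) B <=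
  \sum_i (c i)%:E * Pz (x, y i) (hidden_event (a i) `&` B))%E.
Proof.
move=> + la0; elim: n I c y a x B => [|n ih] I c y a x B c0 ma mB dB h.
  (* B only depends on the first observation: it contains all the paths that
     start with the observation x, or none of them *)
  have dB1 := obs_determinedE dB.
  have [[w [Bw wx]]|nB] := pselect (exists w, B w /\ obs w 0%N = x); last first.
    rewrite [X in (la%:E * X)%E](_ : _ = 0%E); last first.
      rewrite big1// => i _; rewrite (Pz_determined1_0 qd Pz_law mB dB1) ?mule0//.
      by move=> w Bw; apply: nB; exists (path_cons (x, y i) w).
    by rewrite mule0; apply: sume_ge0 => i _; rewrite mule_ge0 ?lee_fin.
  have Bcons i w' : B (path_cons (x, y i) w').
    by apply: dB Bw => -[|//] _; rewrite wx.
  have PB i : Pz (x, y i) B = 1%E by exact: (Pz_determined1 qd Pz_law mB dB1 (Bcons i w)).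
  have PAB i : Pz (x, y i) (hidden_event (a i) `&` B) = (lik 0 (a i) (obs w) (y i))%:E.
    rewrite /= wx fineK; last by apply: Pz_fin; exact: ma.
    rewrite (Pz_head qd Pz_law); last by apply: measurableI => //; exact: ma.
    rewrite [RHS](Pz_head qd Pz_law); last exact: ma.
    by congr (Pz _ _); apply/seteqP; split=> w' => [[]//|] /= ?; split.
  have PT i : lik 0 setT (obs w) (y i) = 1.
    by rewrite /= (_ : hidden_event setT = setT)// probability_setT.
  have := h w Bw wx.
  under eq_bigr do rewrite PT mulr1.
  under [in X in _ -> X]eq_bigr do rewrite PB mule1.
  under [in X in _ -> (_ <= X)%E]eq_bigr do rewrite PAB -EFinM.
  by rewrite !sumEFin -EFinM lee_fin.
have mAB i : measurable (hidden_event (a i) `&` B) by apply: measurableI => //; exact: ma.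
have intE (C : I -> set path) : (forall i, measurable (C i)) ->
    (\sum_i (c i)%:E * Pz (x, y i) (C i) =
     \int[mu]_x' \sum_i (c i)%:E * step_density (C i) (x, y i) x')%E.
  move=> mC; rewrite ge0_integral_sum//.
  - by apply: eq_bigr => i _; rewrite Pz_density// ge0_integralZl_EFin//; first [exact: measurable_step_density | move=> *; exact: step_density_ge0].
  - by move=> i; apply: measurable_funeM; exact: measurable_step_density.
  - by move=> i x' _; rewrite mule_ge0 ?lee_fin// step_density_ge0.
have msum (C : I -> set path) : (forall i, measurable (C i)) ->
    measurable_fun setT (fun x' => \sum_i (c i)%:E * step_density (C i) (x, y i) x')%E.
  move=> mC; apply: emeasurable_sum => i; apply: measurable_funeM.
  exact: measurable_step_density.
have sum0 (C : I -> set path) x' : (0 <= \sum_i (c i)%:E * step_density (C i) (x, y i) x')%E.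
  by apply: sume_ge0 => i _; rewrite mule_ge0 ?lee_fin// step_density_ge0.
rewrite (intE (fun=> B))// (intE (fun i => hidden_event (a i) `&` B))//.
rewrite -ge0_integralZl_EFin//; last exact: (msum (fun=> B)).
apply: ge0_le_integral => //.
- by move=> x' _; rewrite mule_ge0 ?lee_fin// sum0.
- by apply: measurable_funeM; exact: (msum (fun=> B)).
- exact: msum.
move=> x' _.
pose B1 := path_cons (x, ord0) @^-1` B.
have consB i : path_cons (x, y i) @^-1` B = B1.
  by apply/seteqP; split=> w; apply: dB => -[].
have mB1 : measurable B1 by exact: measurable_preimage (measurable_path_cons _) mB.
have dB1 : obs_determined n.+1 B1.
  by move=> w w' ww'; apply: dB => -[|k] // kn; exact: ww'.
pose c1 (p : I * Y) := c p.1 * q (x', p.2) (x, y p.1).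
have sumE (C : I -> set path) : (\sum_i (c i)%:E * step_density (C i) (x, y i) x' =
   \sum_p (c1 p)%:E * Pz (x', p.2) (path_cons (x, y p.1) @^-1` C p.1))%E.
  rewrite -(pair_big predT predT (fun i j => ((c1 (i, j))%:E * Pz (x', j) (path_cons (x, y i) @^-1` C i))%E))/=.
  apply: eq_bigr => i _; rewrite /step_density ge0_sume_distrr; last first.
    by move=> j _; rewrite mule_ge0 ?lee_fin.
  by apply: eq_bigr => j _; rewrite EFinM muleA.
rewrite !sumE.
under eq_bigr do rewrite consB.
under [leRHS]eq_bigr do rewrite preimage_setI consB hidden_event_cons/=.
apply: (ih _ c1 (fun p => p.2) (fun p => after (y p.1) (a p.1))) => //.
- by move=> p; rewrite mulr_ge0.
- by move=> p; exact: measurable_hidden_after.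
move=> w Bw wx.
have := h _ Bw erefl.
have likE (e : I -> set (nat -> Y)) :
    \sum_i c i * lik n.+1 (e i) (obs (path_cons (x, ord0) w)) (y i) =
    \sum_p c1 p * lik n (after (y p.1) (e p.1)) (obs w) p.2.
  rewrite -(pair_big predT predT (fun i j => c1 (i, j) * lik n (after (y i) (e i)) (obs w) j))/=.
  apply: eq_bigr => i _; rewrite mulr_sumr; apply: eq_bigr => j _.
  rewrite mulrA; congr (_ * _ * _).
  by rewrite /obs/= -wx.
by rewrite !likE.
Qed.

(** Conditionally on the first k.+1 states this is [lik_lower_bound] for a
    one-element family. *)
Lemma smoothing_lower_bound k n a z (B : set path) (la : R) :
  0 <= la -> measurable_hidden a -> measurable B -> obs_determined (k + n.+1) B ->
  (forall w, B w -> forall i, la * lik n setT (obs (shift k w)) i <=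
                                  lik n a (obs (shift k w)) i) ->
  (la%:E * Pz z B <= Pz z (B `&` shift k @^-1` hidden_event a))%E.
Proof.
move=> la0 ma mB dB h.
have mS := measurable_preimage (@measurable_shift _ X N k) ma.
apply: (Pz_le_splice qd Pz_law (k := k)) => //; first exact: measurableI.
move=> w0.
pose B1 := splice k w0 @^-1` B.
have -> : splice k w0 @^-1` (B `&` shift k @^-1` hidden_event a) = hidden_event a `&` B1.
  by apply/seteqP; split=> w /=; rewrite shift_splice; tauto.
have mB1 : measurable B1 by exact: measurable_preimage (measurable_splice k w0) mB.
have dB1 : obs_determined n.+1 B1.
  move=> w w' ww'; apply: dB => i ikn; rewrite /obs.
  have [ik|ki] := ltnP i k; first by rewrite !splice_lt.
  rewrite -(subnKC ki) !splice_add; apply: ww'.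
  by rewrite ltn_subLR.
have := @lik_lower_bound n 'I_1 (fun=> 1) (fun=> (w0 k).2) (fun=> a) (w0 k).1 B1 la.
rewrite !big_ord1 !mul1e -surjective_pairing; apply => //.
move=> w Bw _; rewrite !big_ord1 !mul1r.
by have := h _ Bw (w0 k).2; rewrite shift_splice.
Qed.

End likelihood.

(** * Accessibility of blocks in E *)
Section integral_ae0.
Import HBNNSimple.

(** The integral is a supremum over the simple functions below f, all of which
    vanish almost everywhere. The argument covers functions f that are not
    measurable. *)
Lemma integral_ae0 d (T : measurableType d) (R : realType)
    (m : {measure set T -> \bar R}) (f : T -> \bar R) :
  (forall x, 0 <= f x)%E -> {ae m, forall x, f x = 0%E} -> (\int[m]_x f x = 0)%E.
Proof.
move=> f0 aef; rewrite ge0_integralTE//; apply/eqP; rewrite eq_le; apply/andP; split.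
  apply: ge_ereal_sup => _ [h hf <-]; rewrite -integralT_nnsfun.
  rewrite (@ge0_ae_eq_integral _ _ _ _ _ _ (cst 0%E)) ?integral0//.
  - exact/measurable_EFinP.
  - by move=> x _; rewrite lee_fin.
  - apply: filterS aef => x fx _; apply/eqP; rewrite eq_le /= [X in _ && X]lee_fin fun_ge0 andbT.
    by rewrite -fx; exact: hf.
by apply: ereal_sup_ubound; exists nnsfun0 => //; rewrite sintegral0.
Qed.

End integral_ae0.

Lemma measure_bigcup_eq0 d (T : measurableType d) (R : realType)
    (m : {measure set T -> \bar R}) (F : (set T)^nat) :
  (forall n, measurable (F n)) -> (forall n, m (F n) = 0%E) -> m (\bigcup_n F n) = 0%E.
Proof.
move=> mF F0; apply/negligibleP; first exact: bigcupT_measurable.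
by apply: negligible_bigcup => n; apply/(negligibleP m (mF n)); exact: F0.
Qed.

Section reaching_E.
Context d (X : measurableType d) (N : nat) (R : realType).
Variable mu : {sigma_finite_measure set X -> \bar R}.
Local Notation Y := 'I_N.+1.
Local Notation Z := (X * Y)%type.
Local Notation path := (path_space X N).
Variable q : Z -> Z -> R.
Hypothesis qd : transition_density mu q.
Variable Pz : Z -> probability path R.
Hypothesis Pz_law : forall z, law_from mu q z (Pz z).

Let q0 z' z : 0 <= q z' z. Proof. by case: qd. Qed.

Lemma measurable_window d1 (T1 : measurableType d1) r (V : nat -> T1 -> X) :
  (forall k, (k < r)%N -> measurable_fun setT (V k)) ->
  measurable_fun setT (fun t => window r (fun k => V k t)).
Proof.
move=> mV; apply/measurable_fun_tnthP => i.
rewrite (_ : _ \o _ = V i); first exact: mV.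
by apply/funext => t /=; rewrite tnth_mktuple.
Qed.

Lemma measurable_nth r k : measurable_fun setT (fun x : r.-tuple X => nth point x k).
Proof.
have [kr|rk] := ltnP k r.
  rewrite (_ : (fun _ => _) = (@tnth _ _ ^~ (Ordinal kr))); first exact: measurable_tnth.
  by apply/funext => x; rewrite (tnth_nth point).
rewrite (_ : (fun _ => _) = cst point); first exact: measurable_cst.
by apply/funext => x; rewrite nth_default// size_tuple.
Qed.

Lemma measurable_path_weight r i j :
  measurable_fun setT (fun x : r.-tuple X => path_weight q x i j).
Proof.
rewrite /path_weight.
under eq_fun do rewrite -big_filter.
apply: measurable_sum => y; apply: measurable_prod => k _.
by apply: (measurable_q qd); apply: measurable_fun_pair => //; exact: measurable_nth.
Qed.

Variables (r : nat) (E : set (r.-tuple X)) (Yp : {set Y * Y}).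
Hypothesis A1 : condA1 q E Yp.

Lemma measurable_bounded_part e : measurable (bounded_part q E Yp e).
Proof.
have [_ mE _ _ _] := A1.
rewrite (_ : bounded_part q E Yp e = E `&`
   \bigcap_(ij in [set` Yp]) [set x | e <= path_weight q x ij.1 ij.2 <= e^-1]); last first.
  apply/seteqP; split=> x [Ex h]; split => //; first by move=> [i j] /= /h.
  by move=> i j ij; exact: (h (i, j)).
apply: measurableI => //; apply: fin_bigcap_measurable => // ij _.
rewrite (_ : [set x | _] = (fun x => path_weight q x ij.1 ij.2) @^-1` `[e, e^-1]).
  by apply: measurable_preimage => //; exact: measurable_path_weight.
by apply/seteqP; split=> x /=; rewrite in_itv.
Qed.

Definition window_event n (W : set (n.-tuple X)) : set path :=
  [set w | W (window n (obs w))].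

Lemma measurable_window_event n (W : set (n.-tuple X)) :
  measurable W -> measurable (window_event W).
Proof.
move=> mW; apply: (measurable_preimage (f := fun w : path => window n (obs w))) => //.
apply: (measurable_window (V := fun k (w : path) => (w k).1)) => k _.
exact: (measurableT_comp measurable_fst (measurable_path_coord k)).
Qed.

(** If W is almost surely avoided from the states (x, i), i in S, then for almost
    every x' the section of W at x' is avoided from all their successors
    (x', j) of positive density. Following a set S of hidden states, rather than a
    single one, is necessary because the sequences v in W may need different
    hidden paths. *)
Lemma power_measure_eq0 n (W : set (n.-tuple X)) x (S : {set Y}) :
  measurable W ->
  (forall i, i \in S -> Pz (x, i) (shift 1 @^-1` window_event W) = 0%E) ->
  (forall v, W v -> exists2 i, i \in S & exists j,
      0 < weight q n (fun k => nth point (x :: v) k) i j) ->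
  power_measure mu W = 0%E.
Proof.
elim: n W x S => [|n ih] W x S mW PW posW /=.
  rewrite indicE; case: (boolP (_ \in W)) => //= /set_mem W0.
  have [i iS _] := posW _ W0.
  have := PW i iS.
  rewrite (_ : _ @^-1` _ = setT) ?probability_setT; first by move=> /eqP; rewrite onee_eq0.
  apply/seteqP; split=> // w _; rewrite /window_event/=.
  by rewrite (_ : window 0 _ = [tuple])//; exact: tuple0.
have mE1 : measurable (shift 1 @^-1` window_event W).
  exact: measurable_preimage (measurable_shift 1) (measurable_window_event mW).
pose Wx (x' : X) := [set w : n.-tuple X | W [tuple of x' :: w]].
have mWx x' : measurable (Wx x').
  apply: (measurable_preimage (f := fun w : n.-tuple X => [tuple of x' :: w])) => //.
  exact: (measurable_cons (f := cst x')).
have ae0 i : i \in S -> {ae mu, forall x', step_density q Pz (shift 1 @^-1` window_event W) (x, i) x' = 0%E}.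
  move=> iS; have := PW i iS; rewrite (Pz_density qd Pz_law)// => h.
  have h' : (\int[mu]_x' `|step_density q Pz (shift 1 @^-1` window_event W) (x, i) x'| = 0)%E.
    by rewrite -[RHS]h; apply: eq_integral => x' _; rewrite gee0_abs//; apply: (step_density_ge0 qd).
  have [/(_ h') + _] := @ae_eq_integral_abs _ _ _ mu setT measurableT _
    (measurable_step_density qd Pz_law (x, i) mE1).
  by apply: filterS => x' /(_ I).
have {}ae0 : {ae mu, forall x', forall i, i \in S ->
    step_density q Pz (shift 1 @^-1` window_event W) (x, i) x' = 0%E}.
  have : {ae mu, forall x', forall k : nat, forall i : Y, k = i -> i \in S ->
    step_density q Pz (shift 1 @^-1` window_event W) (x, i) x' = 0%E}.
    apply/ae_foralln => k; have [kN|kN] := ltnP k N.+1; last first.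
      by apply: nearW => x' i ki; move: kN; rewrite ki leqNgt ltn_ord.
    have [iS|iS] := boolP (Ordinal kN \in S).
      apply: filterS (ae0 _ iS) => x' h i ki _.
      by rewrite -[RHS]h; congr step_density; congr (_, _); apply: val_inj.
    apply: nearW => x' i ki; rewrite (_ : i = Ordinal kN) ?(negbTE iS)//.
    exact: val_inj.
  by apply: filterS => x' h i iS; exact: (h i).
apply: integral_ae0.
  have pm0 m (V : set (m.-tuple X)) : (0 <= power_measure mu V)%E.
    elim: m V => [|m ihm] V /=; first by rewrite lee_fin.
    by apply: integral_ge0 => x' _; exact: ihm.
  by move=> x'; exact: pm0.
apply: filterS ae0 => x' h.
pose S' := [set j | [exists i in S, 0 < q (x', j) (x, i)]]%SET.
apply: (ih (Wx x') x' S') => //.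
  move=> j; rewrite finset.inE => /exists_inP[i iS qp].
  have hs := h i iS.
  have : ((q (x', j) (x, i))%:E * Pz (x', j) (path_cons (x, i) @^-1` (shift 1 @^-1` window_event W)) == 0)%E.
    rewrite eq_le mule_ge0 ?lee_fin// andbT -hs /step_density (bigD1 j)//= leeDl//.
    by apply: sume_ge0 => l _; rewrite mule_ge0 ?lee_fin.
  rewrite mule_eq0 eqe (gt_eqF qp)/= => /eqP.
  have mE2 : measurable (window_event W) := measurable_window_event mW.
  rewrite (_ : path_cons _ @^-1` _ = window_event W)//.
  rewrite (Pz_head qd Pz_law)// => <-.
  have mE3 : measurable (shift 1 @^-1` window_event (Wx x')).
    exact: measurable_preimage (measurable_shift 1) (measurable_window_event (mWx x')).
  rewrite [LHS](Pz_head qd Pz_law _ mE3); congr (Pz _ _).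
  apply/seteqP; rewrite /window_event/Wx/=.
  suff wE w : [tuple of x' :: window n (obs (shift 1 (path_cons (x', j) (shift 1 w))))] =
      window n.+1 (obs (path_cons (x', j) (shift 1 w))).
    by split=> w /=; rewrite wE.
  exact/esym/windowS.
move=> v Wv; have [i iS [j]] := posW _ Wv.
move=> /lt0r_neq0 /=; rewrite psumr_neq0; last first.
  by move=> l _; apply: mulr_ge0 => //; exact: weight_ge0.
move=> /hasP[l _]/=; rewrite /sdrop/= => qw.
have qp : 0 < q (x', l) (x, i).
  rewrite lt0r q0 andbT; apply: contraTneq qw => qE.
  by rewrite [X in X * _]qE mul0r ltxx.
exists l; first by rewrite finset.inE; apply/exists_inP; exists i.
exists j; move: qw; rewrite pmulr_rgt0//.
Qed.

End reaching_E.

Section accessible_blocks.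
Context d (X : measurableType d) (N : nat) (R : realType).
Variable mu : {sigma_finite_measure set X -> \bar R}.
Local Notation Y := 'I_N.+1.
Local Notation Z := (X * Y)%type.
Local Notation path := (path_space X N).
Variable q : Z -> Z -> R.
Hypothesis qd : transition_density mu q.
Variable Pz : Z -> probability path R.
Hypothesis Pz_law : forall z, law_from mu q z (Pz z).
Variables (r : nat) (E : set (r.+1.-tuple X)) (Yp : {set Y * Y}).
Hypothesis A1 : condA1 q E Yp.
Variable psi : {sigma_finite_measure set Z -> \bar R}.
Hypothesis A2 : condA2 mu Pz psi E Yp.

Let mE : measurable E. Proof. by have [_ ? _ _ _] := A1. Qed.

Lemma sectionE x1 : section E x1 = [set w : r.-tuple X | E [tuple of x1 :: w]].
Proof.
apply/seteqP; split=> w /=; last by move=> Ew; exists [tuple of x1 :: w].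
by move=> [x Ex xw]; rewrite (_ : [tuple of _] = x)//; exact: val_inj.
Qed.

Lemma window_cons x1 (v : r.-tuple X) :
  window r.+1 (fun k => nth point (x1 :: v) k) = [tuple of x1 :: v].
Proof. by apply: eq_from_tnth => k; rewrite tnth_mktuple (tnth_nth point). Qed.

(** Otherwise [power_measure_eq0] would contradict the positivity of the measure of
    the section of E. *)
Lemma reach_E_gt0 z : first_proj E z.1 -> z.2 \in [set ij.1 | ij in Yp]%SET ->
  (0 < Pz z (window_event E))%E.
Proof.
case: z => x1 i /= Ex1 iA; rewrite lt0e measure_ge0 andbT; apply/eqP => P0.
have [_ _ /(_ x1 Ex1)] := A2.
have [_ _ _ EYp _] := A1.
rewrite (@power_measure_eq0 _ _ _ _ _ _ qd _ Pz_law _ _ x1 [set i]%SET) ?ltxx//.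
- rewrite sectionE.
  apply: (measurable_preimage (f := fun w : r.-tuple X => [tuple of x1 :: w])) => //.
  exact: (measurable_cons (f := cst x1)).
- move=> _ /set1P ->; rewrite -[RHS]P0.
  have mW : measurable (section E x1).
    rewrite sectionE.
    apply: (measurable_preimage (f := fun w : r.-tuple X => [tuple of x1 :: w])) => //.
    exact: (measurable_cons (f := cst x1)).
  have mW1 := measurable_preimage (@measurable_shift _ X N 1) (measurable_window_event mW).
  rewrite [LHS](Pz_head qd Pz_law _ mW1) [RHS](Pz_head qd Pz_law _ (measurable_window_event mE)).
  congr (Pz _ _); rewrite /window_event sectionE.
  by apply/seteqP; split=> w /=; rewrite windowS.
- move=> v; rewrite sectionE => Ev; exists i; first exact/set1P.
  move/imsetP: iA => [[i' j] ij /= ->]; exists j.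
  rewrite -path_weight_window window_cons.
  by move: ij; rewrite -(EYp _ Ev) finset.inE.
Qed.

Lemma bounded_part_cover x : E x -> exists n, bounded_part q E Yp n.+2%:R^-1 x.
Proof.
move=> Ex; have [_ _ _ EYp _] := A1.
pose M := \sum_(ij in Yp) (path_weight q x ij.1 ij.2 + (path_weight q x ij.1 ij.2)^-1).
have pw0 ij : ij \in Yp -> 0 < path_weight q x ij.1 ij.2.
  by rewrite -(EYp _ Ex) finset.inE.
have MM ij : ij \in Yp -> path_weight q x ij.1 ij.2 + (path_weight q x ij.1 ij.2)^-1 <= M.
  move=> h; rewrite /M (bigD1 ij)//= lerDl; apply: sumr_ge0 => k /andP[/pw0 k0 _].
  by apply: addr_ge0; rewrite ?invr_ge0; exact: ltW.
have M0 : 0 <= M.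
  by apply: sumr_ge0 => k /pw0 k0; rewrite addr_ge0 ?invr_ge0 ?ltW.
exists (Num.truncn M); split => // i j ij.
have Mn : M <= (Num.truncn M).+2%:R.
  by rewrite (le_trans (ltW (truncnS_gt M)))// ler_nat.
have n0 : 0 < (Num.truncn M).+2%:R :> R by rewrite ltr0n.
have p0 := pw0 _ ij; have pM := MM _ ij; rewrite /= in p0 pM.
have pi0 : 0 < (path_weight q x i j)^-1 by rewrite invr_gt0.
apply/andP; split.
  by rewrite -[leRHS]invrK lef_pV2 ?posrE//; lra.
by rewrite invrK; lra.
Qed.

(** The projection of E may fail to be measurable, but it is covered by the
    measurable sets D n m on which a good block has probability at least
    m.+1%:R^-1 for e = n.+2%:R^-1. If all of them were psi-null, the outer measure
    of the projection would vanish. *)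
Lemma accessible_blocks : exists e delta : R, exists2 D,
  [/\ 0 < e < 1, 0 < delta & measurable D] & (0 < psi D)%E /\
    forall z, D z -> (delta%:E <= Pz z (window_event (bounded_part q E Yp e)))%E.
Proof.
apply: contrapT => hn.
pose B n := window_event (N := N) (bounded_part q E Yp n.+2%:R^-1).
have mB n : measurable (B n).
  by apply: measurable_window_event; exact: (measurable_bounded_part qd A1).
pose D n m := [set z | (m.+1%:R^-1%:E <= Pz z (B n))%E].
have mD n m : measurable (D n m).
  rewrite -[D n m]setTI; apply: emeasurable_fun_c_infty => //.
  exact: (measurable_Pz qd Pz_law).
have D0 n m : psi (D n m) = 0%E.
  apply: contrapT => /eqP psiD; apply: hn.
  exists n.+2%:R^-1, m.+1%:R^-1, (D n m); last first.
    by split; [rewrite lt0e psiD measure_ge0|move=> z].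
  split => //.
  by rewrite invr_gt0 ltr0n/= invf_lt1 ?ltr0n// ltr1n.
pose U := \bigcup_n \bigcup_m D n m.
have mU : measurable U by apply: bigcupT_measurable => n; exact: bigcupT_measurable.
have U0 : psi U = 0%E.
  apply: measure_bigcup_eq0 => n; first exact: bigcupT_measurable.
  by apply: measure_bigcup_eq0 => m; [exact: mD|exact: D0].
have [_ + _] := A2; rewrite ltNge => /negP; apply.
rewrite -U0 -measurable_mu_extE//; apply: le_outer_measure.
move=> z [Ez zA]; have pz := reach_E_gt0 Ez zA.
have [n Bn] : exists n, (0 < Pz z (B n))%E.
  apply: contrapT => /forallNP h.
  have B0 : Pz z (\bigcup_n B n) = 0%E.
    apply: measure_bigcup_eq0 => // n; apply/eqP; rewrite eq_le measure_ge0 andbT.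
    by rewrite leNgt; apply/negP; exact: h.
  move: pz; rewrite ltNge -B0 => /negP; apply; apply: measure_mono.
  - exact: measurable_window_event.
  - exact: bigcupT_measurable.
  - by move=> w /bounded_part_cover[n ?]; exists n.
have Bfin : Pz z (B n) \is a fin_num by exact: fin_num_measure.
have f0 : 0 < fine (Pz z (B n)) by rewrite fine_gt0// Bn -ge0_fin_numE.
exists n => //; exists (Num.truncn (fine (Pz z (B n)))^-1) => //.
rewrite /D/= -(fineK Bfin) lee_fin -[leRHS]invrK lef_pV2 ?posrE ?invr_gt0//.
by rewrite ltW// truncnS_gt.
Qed.

End accessible_blocks.

(** * Lower bounds for smoothing probabilities *)
Section smoothing.
Context d (X : measurableType d) (N : nat) (R : realType).
Variable mu : {sigma_finite_measure set X -> \bar R}.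
Local Notation Y := 'I_N.+1.
Local Notation Z := (X * Y)%type.
Local Notation path := (path_space X N).
Variable q : Z -> Z -> R.
Hypothesis qd : transition_density mu q.
Variable Pz : Z -> probability path R.
Hypothesis Pz_law : forall z, law_from mu q z (Pz z).
Context d' (Omega : measurableType d') (P : probability Omega R).
Variable Zs : nat -> Omega -> Z.
Hypothesis Zs_markov : markov_chain mu q P Zs.

Let mXs k : (1 <= k)%N -> measurable_fun setT (Xs Zs k).
Proof.
move=> k1; have [h _] := Zs_markov; exact: (measurableT_comp measurable_fst (h k k1)).
Qed.

Lemma sub_obs_generators l n : (1 <= l)%N ->
  <<s generators [set k | (l <= k <= n)%N] (Xs Zs) >> `<=` measurable.
Proof.
move=> l1; apply: smallest_sub; first exact: sigma_algebra_measurable.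
move=> _ [k /= /andP[lk kn] [A mA <-]]; apply: mXs => //; exact: leq_trans lk.
Qed.

Lemma obs_event_trajectory l n B : (1 <= l)%N ->
  <<s generators [set k | (l <= k <= n)%N] (Xs Zs) >> B ->
  exists C : set path, [/\ measurable C, obs_determined n C & B = trajectory Zs @^-1` C].
Proof.
move=> l1; move: B; apply: smallest_sub.
  split.
  - by exists set0; split.
  - move=> _ [C [mC dC ->]]; exists (~` C); split.
    + exact: measurableC.
    + by move=> w w' ww' nC Cw'; apply: nC; apply: dC Cw' => k kn; rewrite ww'.
    + by apply/seteqP; split=> w /=; [move=> [_]|move=> ?; split].
  - move=> F hF; have [C hC] := choice hF.
    exists (\bigcup_k C k); split.
    + by apply: bigcupT_measurable => k; have [] := hC k.
    + by move=> w w' ww' [k _ Ck]; exists k => //; have [_ dC _] := hC k; exact: dC Ck.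
    + rewrite preimage_bigcup; apply: eq_bigcupr => k _; by have [] := hC k.
move=> _ [k /= /andP[lk kn] [A mA <-]].
have k1 : (0 < k)%N by exact: leq_trans lk.
exists [set w : path | A (obs w k.-1)]; split.
- apply: (measurable_preimage (f := fun w : path => (w k.-1).1)) => //.
  exact: (measurableT_comp measurable_fst (measurable_path_coord k.-1)).
- by move=> w w' ww' /=; rewrite ww'// prednK.
- by rewrite setTI; apply/seteqP; split=> w /=; rewrite /obs/trajectory/Xs prednK.
Qed.

(** t is the delay of the block with respect to the first hidden state. *)
Definition hidden_block t m (S : {set m.-tuple Y}) : set (nat -> Y) :=
  [set y | [tuple y (t + i)%N | i < m] \in S].

Lemma measurable_hidden_block t m (S : {set m.-tuple Y}) :
  measurable_hidden X (hidden_block t S).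
Proof.
rewrite /measurable_hidden (_ : hidden_event _ =
   \bigcup_(v in [set` S]) \bigcap_(i in [set: 'I_m])
     [set w : path | (w (t + i)%N).2 = tnth v i]); last first.
  apply/seteqP; split=> w.
    move=> wS; exists [tuple hidden w (t + i)%N | i < m] => // i _ /=.
    by rewrite tnth_mktuple.
  move=> [v vS h]; rewrite /hidden_event/hidden_block/=.
  rewrite (_ : [tuple _ | i < m] = v)//; apply: eq_from_tnth => i.
  by rewrite tnth_mktuple; exact: h.
apply: fin_bigcup_measurable; first exact: finite_finset.
move=> v _; apply: fin_bigcap_measurable => [|i _]; first exact: finite_finset.
apply: (measurable_preimage (f := fun w : path => (w (t + i)%N).2) (A := [set tnth v i])) => //.
exact: (measurableT_comp measurable_snd (measurable_path_coord _)).
Qed.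

(** If N is an event of the observations on which the hypothesis on the
    likelihoods holds but f < la', then [smoothing_lower_bound] gives
    la * P N <= P (N and the block is in S), which is the integral of f over N and
    at most la' * P N; hence P N = 0. The likelihoods start from time s, so that
    the levels la do not depend on l. *)
Lemma smoothing_prob_lower_bound l s t n m (S : {set m.-tuple Y}) (f : Omega -> R)
    (la la' : R) :
  (1 <= l)%N -> (l <= s)%N -> (s <= t)%N -> (t <= n)%N ->
  cond_prob P (generators [set k | (l <= k <= n)%N] (Xs Zs))
    [set w | Yblock Zs t m w \in S] (fun w => (f w)%:E) ->
  (forall w, 0 <= f w) -> 0 <= la' < la ->
  {ae P, forall w,
    (forall i, la * lik q Pz (n - s) setT (fun k => Xs Zs (s + k) w) i <=
        lik q Pz (n - s) (hidden_block (t - s) S) (fun k => Xs Zs (s + k) w) i) ->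
    la' <= f w}.
Proof.
move=> l1 ls st tn [mf intf fE] f0 /andP[la'0 lala'].
set G := generators _ _ in mf fE *.
have sG : <<s G >> `<=` measurable by exact: sub_obs_generators.
have ma := measurable_hidden_block (t - s) S.
set a := hidden_block (t - s) S in ma *.
have maT : measurable_hidden X (@setT (nat -> Y)).
  by rewrite /measurable_hidden (_ : hidden_event _ = setT).
pose good (x : nat -> X) := forall i, la * lik q Pz (n - s) setT x i <= lik q Pz (n - s) a x i.
have mgood d1 (T1 : measurableType d1) (V : nat -> T1 -> X) :
    (forall k, (k <= n - s)%N -> measurable_fun setT (V k)) ->
    measurable [set w | good (fun k => V k w)].
  move=> mV; rewrite (_ : [set w | _] = \bigcap_(i in [set: Y])
     [set w | la * lik q Pz (n - s) setT (fun k => V k w) i <=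
              lik q Pz (n - s) a (fun k => V k w) i]); last first.
    by apply/seteqP; split=> w h i; [move=> _; exact: h|exact: (h i I)].
  apply: fin_bigcap_measurable => [|i _]; first exact: finite_finset.
  have m1 : measurable_fun setT (fun w => la * lik q Pz (n - s) setT (fun k => V k w) i).
    by apply: measurable_funM => //; exact: (measurable_lik qd Pz_law).
  have m2 : measurable_fun setT (fun w => lik q Pz (n - s) a (fun k => V k w) i).
    exact: (measurable_lik qd Pz_law).
  have := measurable_fun_ler m1 m2; move=> /(_ measurableT [set true] I).
  by rewrite setTI.
pose A := [set w | good (fun k => Xs Zs (s + k) w)].
pose F := [set w | f w < la'].
have GA : <<s G >> A.
  apply: (mgood _ (g_sigma_algebraType G) (fun k => Xs Zs (s + k))) => k kns.
  move=> _ C mC; rewrite setTI; apply: sub_sigma_algebra.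
  exists (s + k)%N => /=; last by exists C => //; rewrite setTI.
  by rewrite (leq_trans ls (leq_addr _ _))/= -leq_subRL// (leq_trans st).
have GF : <<s G >> F.
  have := @emeasurable_fun_infty_o _ (g_sigma_algebraType G) R setT _ measurableT mf la'%:E.
  by rewrite setTI; congr (<<s G >> _); apply/seteqP; split=> w /=; rewrite lte_fin.
have GAF : <<s G >> (A `&` F).
  exact: (@measurableI _ (g_sigma_algebraType G)).
have [C [mC dC AFE]] := obs_event_trajectory l1 GAF.
(* the event C may fail to imply the bound on the likelihoods outside the range
   of the trajectories *)
pose gs := [set w : path | good (obs (shift s.-1 w))].
have s1 : (0 < s)%N by exact: leq_trans l1 ls.
have obs_traj w : obs (shift s.-1 (trajectory Zs w)) = fun k => Xs Zs (s + k) w.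
  by apply/funext => k; rewrite /obs/shift/trajectory/Xs -addSn prednK.
have mgs : measurable gs.
  apply: (mgood _ path (fun k (w : path) => (w (s.-1 + k)%N).1)) => k _.
  exact: (measurableT_comp measurable_fst (measurable_path_coord _)).
pose C' := C `&` gs.
have C'E : trajectory Zs @^-1` C' = A `&` F.
  rewrite preimage_setI -AFE; apply/seteqP; split=> w; first by case.
  by move=> AF; split => //; rewrite /gs/= obs_traj; case: AF.
have mC' : measurable C' by exact: measurableI.
have dC' : obs_determined (s.-1 + (n - s).+1) C'.
  have -> : (s.-1 + (n - s).+1)%N = n.
    by rewrite addnS -addSn prednK// subnKC// (leq_trans st).
  move=> w w' ww' [Cw gw]; split; first exact: dC Cw.
  move=> i; have E a0 : lik q Pz (n - s) a0 (obs (shift s.-1 w')) i =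
      lik q Pz (n - s) a0 (obs (shift s.-1 w)) i.
    apply: eq_lik => k kns; apply/esym; apply: (ww' (s.-1 + k)%N).
    rewrite -(ltn_add2l 1) !add1n -addSn prednK// ltnS.
    by rewrite -leq_subRL// (leq_trans st).
  by rewrite !E; exact: gw.
have mAF : measurable (A `&` F) by exact: sG.
have ms1 := measurable_preimage (@measurable_shift _ X N s.-1) ma.
have le1 : (la%:E * P (A `&` F) <= P ([set w | Yblock Zs t m w \in S] `&` (A `&` F)))%E.
  have -> : [set w | Yblock Zs t m w \in S] `&` (A `&` F) =
      trajectory Zs @^-1` (C' `&` shift s.-1 @^-1` hidden_event a).
    rewrite preimage_setI C'E setIC; congr (_ `&` _).
    apply/seteqP; split=> w; rewrite /hidden_event/a/hidden_block/=;
    suff -> : [tuple hidden (shift s.-1 (trajectory Zs w)) (t - s + i)%N | i < m] =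
       Yblock Zs t m w by [];
    apply: eq_from_tnth => i; rewrite !tnth_mktuple /hidden/shift/trajectory;
    by rewrite addnA -!addSn prednK// subnKC.
  rewrite -C'E !(trajectory_law qd Pz_law Zs_markov)//; last exact: measurableI.
  have mZ1 : measurable_fun setT (Zs 1%N) by have [h _] := Zs_markov; exact: h.
  rewrite -ge0_integralZl_EFin//; last 2 first.
    exact: (measurableT_comp (measurable_Pz qd Pz_law mC') mZ1).
    exact: le_trans (ltW lala').
  apply: ge0_le_integral => //.
  - by move=> w _; rewrite mule_ge0// lee_fin (le_trans _ (ltW lala')).
  - apply: measurable_funeM.
    exact: (measurableT_comp (measurable_Pz qd Pz_law mC') mZ1).
  - apply: (measurableT_comp (measurable_Pz qd Pz_law _) mZ1).
    exact: measurableI.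
  - move=> w _; apply: (smoothing_lower_bound qd Pz_law) dC' _ => //.
      exact: le_trans (ltW lala').
    by move=> w' [].
have le2 : (P ([set w | Yblock Zs t m w \in S] `&` (A `&` F)) <= la'%:E * P (A `&` F))%E.
  rewrite -(fE _ GAF) -integral_cst//.
  have mfT : measurable_fun setT (fun w => (f w)%:E) by exact: measurable_int intf.
  apply: ge0_le_integral.
  - exact: mAF.
  - by move=> w _; rewrite lee_fin.
  - exact: measurable_funTS.
  - exact: measurable_cst.
  - by move=> w [_ Fw]; rewrite lee_fin ltW.
have PAF0 : P (A `&` F) = 0%E.
  have := le_trans le1 le2.
  have PAFfin : P (A `&` F) \is a fin_num by exact: fin_num_measure.
  rewrite -(fineK PAFfin) -!EFinM lee_fin => h; congr EFin.
  have : 0 <= fine (P (A `&` F)) by rewrite fine_ge0.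
  by nra.
exists (A `&` F); split => // w /= /not_implyP[gw /negP].
by rewrite -ltNge => ?; split.
Qed.

End smoothing.

(** * Total variation of conditional laws *)
Lemma ae_forall_count d (T : measurableType d) (R : realType)
    (m : {measure set T -> \bar R}) (I : countType) (Q : I -> T -> Prop) :
  (forall i, {ae m, forall x, Q i x}) -> {ae m, forall x, forall i, Q i x}.
Proof.
move=> h.
have : {ae m, forall x, forall k : nat, forall i, @choice.unpickle I k = Some i -> Q i x}.
  apply/ae_foralln => k; case E : (@choice.unpickle I k) => [i|]; last by apply: nearW.
  by apply: filterS (h i) => x Qi j [<-].
by apply: filterS => x hx i; apply: (hx (choice.pickle i)); exact: choice.pickleK.
Qed.

Section conditional_law_of_sets.
Context d (Omega : measurableType d) (R : realType) (P : probability Omega R).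

Lemma cond_law_set (S : finType) (G : set_system Omega) (V : Omega -> S)
    (nu : Omega -> S -> R) (A : {set S}) :
  <<s G >> `<=` measurable -> (forall v, measurable (V @^-1` [set v])) ->
  cond_law P G V nu ->
  cond_prob P G [set w | V w \in A] (fun w => (\sum_(v in A) nu w v)%:E).
Proof.
move=> sG mV [nup nuE].
have E w : ((\sum_(v in A) nu w v)%:E = \sum_(v <- enum A) (nu w v)%:E)%E.
  by rewrite sumEFin big_enum.
rewrite (funext E); split.
- by apply: (@emeasurable_sum _ (g_sigma_algebraType G)) => v; have [] := nuE v.
- by apply: integrable_sum => // v _; have [] := nuE v.
move=> B GB; have mB := sG _ GB.
rewrite ge0_integral_sum//; last 2 first.
- move=> v; apply: measurable_funTS; have [_ + _] := nuE v; exact: measurable_int.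
- by move=> v w _; rewrite lee_fin; have [] := nup w.
rewrite (_ : _ `&` B = \bigcup_(v in [set` enum A]) (V @^-1` [set v] `&` B)); last first.
  apply/seteqP; split=> w; first by move=> [/= VA Bw]; exists (V w); rewrite //= mem_enum.
  by move=> [v /=]; rewrite mem_enum => vA [-> Bw].
rewrite measure_fin_bigcup//.
- rewrite -fsbig_seq ?enum_uniq//; apply: eq_bigr => v _.
  by have [_ _ ->] := nuE v.
- by apply/trivIsetP => i j _ _ ij; apply/seteqP; split=> w // [[/= Vi _] [/= Vj _]]; rewrite -Vi -Vj eqxx in ij.
- by move=> v _; exact: measurableI.
Qed.

End conditional_law_of_sets.

Section tv.
Context (R : realType) (S : finType).

(** Take for A the set where p v - p' v is nonnegative, and its complement. *)
Lemma tv_norm_le (p p' : S -> R) (D : R) :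
  (forall A : {set S}, `|\sum_(v in A) p v - \sum_(v in A) p' v| <= D) ->
  tv_norm (fun v => p v - p' v) <= 2 * D.
Proof.
move=> h; pose A := [set v | p' v <= p v]%SET.
rewrite /tv_norm (bigID (mem A))/=.
have -> : \sum_(v in A) `|p v - p' v| = \sum_(v in A) p v - \sum_(v in A) p' v.
  by rewrite -sumrB; apply: eq_bigr => v; rewrite finset.inE => vA; rewrite ger0_norm// subr_ge0.
have -> : \sum_(v | v \notin A) `|p v - p' v| = \sum_(v in ~: A) p' v - \sum_(v in ~: A) p v.
  rewrite -sumrB; apply: eq_big => v; first by rewrite finset.in_setC.
  by rewrite finset.inE -ltNge => vA; rewrite ltr0_norm ?subr_lt0// opprB.
have := h A; have := h (~: A)%SET; rewrite !ler_norml => /andP[h1 h2] /andP[h3 h4]; lra.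
Qed.

End tv.

Section prob_bounds.
Context (R : realType) (I S : finType) (b : I -> R) (g : {set S} -> I -> R) (D : R).
Hypothesis b0 : forall i, 0 <= b i.
Hypothesis gC : forall A i, g (~: A)%SET i = b i - g A i.
Hypothesis gD : forall A, bracketed D b (g A).

(** If c * b <= g A for all indices, then c bounds p A and p' A from below; the
    complement of A gives the upper bounds, so that p A and p' A lie in the same
    bracket. The levels are rational in order that almost sure lower bounds hold
    for all of them at once. *)
Lemma tv_norm_bracketed (p p' : S -> R) :
  (forall v, 0 <= p v) -> \sum_v p v = 1 -> (forall v, 0 <= p' v) -> \sum_v p' v = 1 ->
  (forall (A : {set S}) (la la' : rat), 0 <= la' < la ->
     (forall i, ratr la * b i <= g A i) ->
     ratr la' <= \sum_(v in A) p v /\ ratr la' <= \sum_(v in A) p' v) ->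
  tv_norm (fun v => p v - p' v) <= 2 * D.
Proof.
move=> p0 p1 p'0 p'1 h; apply: tv_norm_le => A.
have lower (u : S -> R) : (forall v, 0 <= u v) ->
  (forall (A : {set S}) (la la' : rat), 0 <= la' < la ->
     (forall i, ratr la * b i <= g A i) -> ratr la' <= \sum_(v in A) u v) ->
  forall (A : {set S}) c, (forall i, c * b i <= g A i) -> c <= \sum_(v in A) u v.
  move=> u0 hu A1 c hc; rewrite leNgt; apply/negP => uc.
  have [la' ] := rat_in_itvoo uc; rewrite in_itv/= => /andP[ula' la'c].
  have [la ] := rat_in_itvoo la'c; rewrite in_itv/= => /andP[la'la lac].
  have la'0 : 0 <= la'.
    rewrite -(ler_rat R) rmorph0; apply: le_trans (ltW ula'); exact: sumr_ge0.
  have lala' : la' < la by rewrite -(ltr_rat R).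
  have := hu A1 la la'; rewrite la'0 lala' => /(_ isT).
  have H i : ratr la * b i <= g A1 i.
    by apply: le_trans (hc i); rewrite ler_wpM2r// ltW.
  by move=> /(_ H); rewrite leNgt ula'.
have lp := lower p p0 (fun A la la' l l' => (h A la la' l l').1).
have lp' := lower p' p'0 (fun A la la' l l' => (h A la la' l l').2).
have [lo [hi [lo0 lh hi1 lohi hb]]] := gD A.
have hlo i : lo * b i <= g A i by have /andP[] := hb i.
have hhi i : (1 - hi) * b i <= g (~: A)%SET i.
  by rewrite gC mulrBl mul1r lerD2l lerN2; have /andP[] := hb i.
have pC (u : S -> R) : \sum_v u v = 1 -> \sum_(v in ~: A) u v = 1 - \sum_(v in A) u v.
  move=> <-; rewrite [in RHS](bigID (mem A))/= addrAC subrr add0r.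
  by apply: eq_bigl => v; rewrite finset.in_setC.
have := lp _ _ hlo; have := lp' _ _ hlo; have := lp _ _ hhi; have := lp' _ _ hhi.
rewrite !pC// ler_norml => *; apply/andP; split; lra.
Qed.

End prob_bounds.

(** * Forgetting *)
Section forgetting.
Context d (X : measurableType d) (N : nat) (R : realType).
Variable mu : {sigma_finite_measure set X -> \bar R}.
Local Notation Y := 'I_N.+1.
Local Notation Z := (X * Y)%type.
Local Notation path := (path_space X N).
Variable q : Z -> Z -> R.
Hypothesis qd : transition_density mu q.
Variable Pz : Z -> probability path R.
Hypothesis Pz_law : forall z, law_from mu q z (Pz z).
Context d' (Omega : measurableType d') (P : probability Omega R).
Variable Zs : nat -> Omega -> Z.
Hypothesis Zs_markov : markov_chain mu q P Zs.
Variables (r : nat) (E : set (r.-tuple X)) (Yp : {set Y * Y}).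
Hypothesis A1 : condA1 q E Yp.
Variable nu : forall t l n m : nat, Omega -> m.-tuple Y -> R.
Arguments nu : clear implicits.
Hypothesis nu_law : smoothing_law P Zs nu.
Variables (e theta : R).
Hypothesis e01 : 0 < e < 1.
Hypothesis theta01 : 0 < theta < 1.
Hypothesis etheta : 1 - e ^+ 2 <= theta ^+ r.

Let q0 z' z : 0 <= q z' z. Proof. by case: qd. Qed.

Definition good_block : set path := window_event (bounded_part q E Yp e).

(** Good blocks of the chain that start at times s, ..., s + n - 1. The trajectory
    is indexed from 0 and the chain from 1, whence the shift by s.-1. *)
Definition good_blocks s n (w : Omega) : nat :=
  visits good_block n (shift s.-1 (trajectory Zs w)).

Lemma good_blocksE s n w : (1 <= s)%N -> good_blocks s n w =
  tally (fun k => `[< bounded_part q E Yp e (window r (sdrop k (fun k => Xs Zs (s + k) w))) >]) n.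
Proof.
move=> s1; rewrite /good_blocks /visits; congr tally; apply/funext => k.
congr (`[< bounded_part _ _ _ _ (window r _) >]); apply/funext => i.
by rewrite /obs/shift/trajectory/sdrop/Xs -addSn prednK.
Qed.

(** Both smoothing laws exceed the same levels, those of the likelihoods from
    time s on, and these are bracketed by [bracketed_backward]. *)
Lemma ae_tv_norm_le l s t n m : (1 <= l)%N -> (l <= s)%N -> (s <= t)%N -> (t <= n)%N ->
  (1 <= m)%N ->
  {ae P, forall w, tv_norm (fun v => nu t l n m w v - nu t s n m w v) <=
     2 * (theta ^+ good_blocks s (t - s) w / theta ^+ r)}.
Proof.
move=> l1 ls st tn m1.
have s1 : (1 <= s)%N by exact: leq_trans l1 ls.
have lt : (l <= t)%N by exact: leq_trans ls st.
have nul : cond_law P (generators [set k | (l <= k <= n)%N] (Xs Zs)) (Yblock Zs t m) (nu t l n m).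
  by apply: nu_law => //; rewrite ?l1// (leq_trans lt).
have nus : cond_law P (generators [set k | (s <= k <= n)%N] (Xs Zs)) (Yblock Zs t m) (nu t s n m).
  by apply: nu_law => //; rewrite ?s1// (leq_trans st).
have mblock (v : m.-tuple Y) : measurable (Yblock Zs t m @^-1` [set v]).
  rewrite (_ : _ @^-1` _ = \bigcap_(i in [set: 'I_m]) [set w | (Zs (t + i)%N w).2 = tnth v i]).
    apply: fin_bigcap_measurable => [|i _]; first exact: finite_finset.
    apply: (measurable_preimage (f := fun w => (Zs (t + i)%N w).2) (A := [set tnth v i])) => //.
    apply: (measurableT_comp measurable_snd); have [h _] := Zs_markov; apply: h.
    by rewrite (leq_trans l1)// (leq_trans lt)// leq_addr.
  apply/seteqP; split=> w; first by move=> <- i _ /=; rewrite tnth_mktuple.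
  by move=> h; apply: eq_from_tnth => i; rewrite tnth_mktuple; exact: h.
pose lik' := lik q Pz (n - s).
have lower (l' : nat) (f : Omega -> m.-tuple Y -> R) : (1 <= l')%N -> (l' <= s)%N ->
    cond_law P (generators [set k | (l' <= k <= n)%N] (Xs Zs)) (Yblock Zs t m) f ->
    {ae P, forall w, forall (p : {set m.-tuple Y} * (rat * rat)), 0 <= p.2.2 < p.2.1 ->
     (forall i, ratr p.2.1 * lik' setT (fun k => Xs Zs (s + k) w) i <=
        lik' (hidden_block (t - s) p.1) (fun k => Xs Zs (s + k) w) i) ->
     ratr p.2.2 <= \sum_(v in p.1) f w v}.
  move=> l'1 l's flaw; apply: ae_forall_count => -[S [la la']] /=.
  have [la0|nla] := boolP (0 <= la' < la); last by apply: nearW => w.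
  have sG : <<s generators [set k | (l' <= k <= n)%N] (Xs Zs) >> `<=` measurable.
    exact: (sub_obs_generators Zs_markov).
  have := smoothing_prob_lower_bound qd Pz_law Zs_markov l'1 l's st tn
    (cond_law_set S sG mblock flaw) (la := ratr la) (la' := ratr la').
  have [f0 _] := flaw.
  move=> /(_ (fun w => sumr_ge0 _ (fun v _ => (f0 w).1 v))).
  rewrite ltr_rat -(rmorph0 ratr) ler_rat => /(_ la0).
  by apply: filterS => w h _; exact: h.
apply: filterS2 (lower l _ l1 ls nul) (lower s _ s1 (leqnn s) nus) => w hl hs.
have [nul1 _] := nul; have [nus1 _] := nus.
pose x := fun k => Xs Zs (s + k) w.
have maT : measurable_hidden X (@setT (nat -> Y)).
  by rewrite /measurable_hidden (_ : hidden_event _ = setT).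
apply: (@tv_norm_bracketed R _ _ (lik' setT x) (fun S => lik' (hidden_block (t - s) S) x)).
- by move=> i; exact: (lik_ge0 qd).
- move=> S i; rewrite -lik_setC//; last exact: measurable_hidden_block.
  congr (lik' _ _ _); apply/seteqP; split=> y; rewrite /hidden_block/= finset.in_setC.
    by move/negP.
  by move=> /negP.
- move=> S; rewrite good_blocksE//.
  have nE : (n - s = (t - s) + (n - t))%N by rewrite addnC addnBA// subnK.
  have := @bracketed_backward _ _ _ _ q q0 r E Yp A1 e theta
    (fun t' => lik q Pz (t' + (n - t)) setT)
    (fun t' => lik q Pz (t' + (n - t)) (hidden_block t' S)) (t - s) x e01 theta01 etheta.
  rewrite /lik' nE; apply => //.
  + by move=> x' i; rewrite (lik_ge0 qd)/=; apply: (lik_le qd) => //; exact: measurable_hidden_block.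
- by move=> v; have [] := nul1 w.
- by have [] := nul1 w.
- by move=> v; have [] := nus1 w.
- by have [] := nus1 w.
- by move=> S la la' la0 h; split; [exact: (hl (S, (la, la')))|exact: (hs (S, (la, la')))].
Qed.

Lemma ae_sup_tv_le l s : (1 <= l)%N -> (l <= s)%N ->
  {ae P, forall w, forall t, (s <= t)%N ->
    (sup_tv nu t l s w <= (2 * (theta ^+ good_blocks s (t - s) w / theta ^+ r))%:E)%E}.
Proof.
move=> l1 ls.
have : {ae P, forall w, forall t n m, (s <= t)%N -> (t <= n)%N -> (1 <= m)%N ->
   tv_norm (fun v => nu t l n m w v - nu t s n m w v) <=
     2 * (theta ^+ good_blocks s (t - s) w / theta ^+ r)}.
  apply/ae_foralln => t; apply/ae_foralln => n; apply/ae_foralln => m.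
  have [st|_] := leqP s t; last by apply: nearW.
  have [tn|_] := leqP t n; last by apply: nearW.
  have [m1|_] := leqP 1 m; last by apply: nearW.
  by apply: filterS (ae_tv_norm_le l1 ls st tn m1) => w h _ _ _.
apply: filterS => w h t st; apply: ge_ereal_sup => _ [n [m [tn m1 ->]]].
by rewrite lee_fin; exact: h.
Qed.

Lemma sup_tvC t l s w : sup_tv nu t l s w = sup_tv nu t s l w.
Proof.
congr ereal_sup; apply/seteqP; split=> _ [n [m [tn m1 ->]]]; exists n, m; split => //;
by congr EFin; apply: eq_bigr => v _; rewrite distrC.
Qed.

Lemma sup_tv_ge0 t l s w : (0 <= sup_tv nu t l s w)%E.
Proof.
apply: le_trans (ereal_sup_ubound _); last by exists t, 1%N; split.
by rewrite lee_fin; apply: sumr_ge0.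
Qed.

Lemma visits_nd (B : set path) w a b : (a <= b)%N -> (visits B a w <= visits B b w)%N.
Proof. by move=> ab; rewrite -(subnKC ab) visitsD leq_addr. Qed.

Lemma visits_unbounded (B : set path) w K : io B w -> exists n, (K <= visits B n w)%N.
Proof.
move=> h; elim: K => [|K [n ih]]; first by exists 0%N.
have [k nk Bk] := h n; exists (k + 1)%N; rewrite visitsD visitsS.
have -> : `[< B (shift k w) >] by apply/asboolP.
have := visits_nd B w nk; lia.
Qed.

Lemma io_shift (B : set path) k w : io B w -> io B (shift k w).
Proof.
move=> h n; have [j jn Bj] := h (k + n)%N; exists (j - k)%N; first by lia.
by rewrite shiftD subnKC//; lia.
Qed.

Lemma ae_trajectory (A : set path) : measurable A -> (forall z, Pz z A = 1%E) ->
  {ae P, forall w, A (trajectory Zs w)}.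
Proof.
move=> mA A1'; exists (~` (trajectory Zs @^-1` A)).
have mT : measurable (trajectory Zs @^-1` A).
  exact: measurable_preimage (measurable_trajectory Zs_markov) mA.
split => //; first exact: measurableC.
rewrite probability_setC// (trajectory_law qd Pz_law Zs_markov)//.
under eq_integral do rewrite A1'.
rewrite integral_cst// mul1e.
by have := probability_setT P => /= ->; rewrite subee.
Qed.

(** Almost surely there are infinitely many good blocks after time s. *)
Lemma forgetting (l s : nat) : (forall z, Pz z (io good_block) = 1%E) ->
  (1 <= l)%N -> (1 <= s)%N ->
  {ae P, forall w, sup_tv nu t l s w @[t --> \oo] --> 0%E}.
Proof.
move=> ioG.
wlog ls : l s / (l <= s)%N.
  move=> H l1 s1; have [ls|sl] := leqP l s; first exact: H.
  apply: filterS (H s l (ltnW sl) s1 l1) => w.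
  by under eq_fun do rewrite sup_tvC.
move=> l1 s1.
have mG : measurable good_block.
  by apply: measurable_window_event; exact: (measurable_bounded_part qd A1).
apply: filterS2 (ae_sup_tv_le l1 ls) (ae_trajectory (measurable_io mG) ioG) => w hw iow.
have [th0 th1] := andP theta01.
apply: (@squeeze_cvge _ _ _ _ (cst 0%E) _
   (fun t => (2 * (theta ^+ good_blocks s (t - s) w / theta ^+ r))%:E)).
- by exists s => // t /= st; rewrite sup_tv_ge0/=; exact: hw.
- exact: cvg_cst.
- apply: cvg_EFin; first by apply: nearW.
  rewrite [X in _ --> X](_ : _ = 2 * (0 / theta ^+ r)); last by rewrite mul0r mulr0.
  apply: cvgM; first exact: cvg_cst.
  apply: cvgM; last exact: cvg_cst.
  apply: (@cvg_comp _ _ _ (fun t => good_blocks s (t - s) w) (fun k => theta ^+ k) _ \oo).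
    apply/cvgnyPge => K.
    have [n Kn] := visits_unbounded K (io_shift s.-1 iow).
    exists (s + n)%N => // t /= snt; apply: (leq_trans Kn).
    by apply: visits_nd; lia.
  by apply: cvg_expr; rewrite ger0_norm ?ltW.
Qed.

(** Here C s is the supremum over t of the bound in [ae_sup_tv_le] divided by
    alpha ^+ (t - s). As t - s <= M * good_blocks s (t - s) + K, it is at most
    2 / theta ^+ r / alpha ^+ K. *)
Lemma exponential_forgetting (M : nat) (alpha : R) s :
  (forall z, Pz z (linear_visits good_block M) = 1%E) ->
  0 < alpha < 1 -> theta <= alpha ^+ M -> (1 <= s)%N ->
  exists C : Omega -> R,
    generated_measurable (generators [set k | (s <= k)%N] (Xs Zs)) C /\
    forall t l : nat, (1 <= l <= s)%N -> (s <= t)%N ->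
      {ae P, forall w, (sup_tv nu t l s w <= (C w * alpha ^+ (t - s))%:E)%E}.
Proof.
move=> linG /andP[a0 a1] tha s1.
have [th0 th1] := andP theta01.
pose u n w := 2 * (theta ^+ good_blocks s n w / theta ^+ r) / alpha ^+ n.
have u0 n w : 0 <= u n w by rewrite !mulr_ge0 ?invr_ge0 ?exprn_ge0 ?ltW.
pose C w := fine (esups (fun n => (u n w)%:E) 0%N).
have mG : measurable good_block.
  by apply: measurable_window_event; exact: (measurable_bounded_part qd A1).
exists C; split.
  set G := generators _ _.
  apply: (@measurableT_comp _ _ _ (g_sigma_algebraType G)) => //.
  apply: (@measurable_fun_esups _ (g_sigma_algebraType G)) => n.
  apply/measurable_EFinP.
  have mv : measurable_fun setT (good_blocks s n : g_sigma_algebraType G -> nat).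
    rewrite (_ : good_blocks s n = fun w => tally (fun k => `[< bounded_part q E Yp e
       (window r (sdrop k (fun k => Xs Zs (s + k) w))) >]) n); last first.
      by apply/funext => w; rewrite good_blocksE.
    elim: n => [|n ih].
      rewrite (_ : (fun _ => _) = cst 0%N); first exact: measurable_cst.
      by apply/funext => w; rewrite tally0.
    rewrite (_ : (fun _ => _) = fun w => (tally (fun k => `[< bounded_part q E Yp e
       (window r (sdrop k (fun k => Xs Zs (s + k) w))) >]) n +
       `[< bounded_part q E Yp e (window r (sdrop n (fun k => Xs Zs (s + k) w))) >])%N); last first.
      by apply/funext => w; rewrite /tally big_ord_recr.
    apply: measurable_fun_addn => //.
    have mb : measurable_fun setT (fun w : g_sigma_algebraType G => `[< bounded_part q E Yp e
       (window r (sdrop n (fun k => Xs Zs (s + k) w))) >]).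
      apply: (@measurable_fun_bool _ _ _ _ true).
      rewrite setTI (_ : _ @^-1` _ =
         (fun w => window r (sdrop n (fun k => Xs Zs (s + k) w))) @^-1` bounded_part q E Yp e); last first.
        by apply/seteqP; split=> w /= /asboolP.
      apply: measurable_preimage; last exact: (measurable_bounded_part qd A1).
      apply: (@measurable_window _ _ _ (g_sigma_algebraType G) r
         (fun k => Xs Zs (s + (n + k))%N)) => k _.
      move=> _ B mB; rewrite setTI; apply: sub_sigma_algebra.
      by exists (s + (n + k))%N => /=; [exact: leq_addr|exists B => //; rewrite setTI].
    exact: (measurableT_comp (f := nat_of_bool) _ mb).
  exact: (measurableT_comp (f := fun k : nat =>
     2 * (theta ^+ k / theta ^+ r) / alpha ^+ n : R) _ mv).
move=> t l /andP[l1 ls] st.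
apply: filterS2 (ae_sup_tv_le l1 ls) (ae_trajectory (measurable_linear_visits M mG) linG) => w hw linw.
apply: (le_trans (hw t st)).
have [K hK] : linear_visits good_block M (shift s.-1 (trajectory Zs w)) by apply/linear_visits_shift.
have ub n : u n w <= 2 / theta ^+ r / alpha ^+ K.
  have an0 : 0 < alpha ^+ n by rewrite exprn_gt0.
  have aK0 : 0 < alpha ^+ K by rewrite exprn_gt0.
  have h1 : theta ^+ good_blocks s n w <= alpha ^+ (M * good_blocks s n w).
    rewrite exprM; apply: lerXn2r => //; rewrite nnegrE; first exact: ltW.
    by apply: exprn_ge0; exact: ltW.
  have h2 : alpha ^+ (M * good_blocks s n w) * alpha ^+ K <= alpha ^+ n.
    rewrite -exprD; apply: ler_wiXn2l; [exact: ltW|exact: ltW|exact: hK].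
  have h3 : theta ^+ good_blocks s n w / alpha ^+ n <= (alpha ^+ K)^-1.
    rewrite ler_pdivrMr// ler_pdivlMl//; apply: le_trans h2.
    by rewrite mulrC ler_wpM2r// ltW.
  have -> : u n w = 2 / theta ^+ r * (theta ^+ good_blocks s n w / alpha ^+ n).
    by rewrite /u; ring.
  by rewrite ler_wpM2l// mulr_ge0// invr_ge0 exprn_ge0// ltW.
have Cge : ((u (t - s)%N w)%:E <= esups (fun n => (u n w)%:E) 0%N)%E.
  by apply: ereal_sup_ubound; exists (t - s)%N.
have Cle : (esups (fun n => (u n w)%:E) 0%N <= (2 / theta ^+ r / alpha ^+ K)%:E)%E.
  by apply: ge_ereal_sup => _ [n _ <-]; rewrite lee_fin; exact: ub.
have Cfin : esups (fun n => (u n w)%:E) 0%N \is a fin_num.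
  rewrite ge0_fin_numE; first by rewrite (le_lt_trans Cle)// ltry.
  by apply: le_trans Cge; rewrite lee_fin.
rewrite lee_fin -ler_pdivrMr ?exprn_gt0//.
by rewrite -lee_fin /C fineK.
Qed.

End forgetting.

Unset Implicit Arguments.

Theorem theorem3p1 (R : realType)
  (T : ptopologicalType) (polishT : polish_space R T)
  (N : nat)
  (mu : {sigma_finite_measure set (borel T) -> \bar R})
  (q : borel T * 'I_N.+1 -> borel T * 'I_N.+1 -> R)
  (q_density : transition_density mu q)
  (d : measure_display) (Omega : measurableType d) (P : probability Omega R)
  (Z : nat -> Omega -> borel T * 'I_N.+1)
  (Z_markov : markov_chain mu q P Z)
  (Z1_density : has_density mu (fun C => P (Z 1%N @^-1` C)))
  (Pz : borel T * 'I_N.+1 -> probability (path_space (borel T) N) R)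
  (Pz_law : forall z, law_from mu q z (Pz z))
  (psi : {sigma_finite_measure set (borel T * 'I_N.+1)%type -> \bar R})
  (r : nat) (E : set (r.-tuple (borel T))) (Yp : {set ('I_N.+1 * 'I_N.+1)%type})
  (A1 : condA1 q E Yp)
  (A2 : condA2 mu Pz psi E Yp)
  (Z_harris : harris_recurrent Pz psi)
  (nu : forall t l n m : nat, Omega -> m.-tuple 'I_N.+1 -> R)
  (nu_law : smoothing_law P Z nu) :
  (forall l s : nat, (1 <= l)%N -> (1 <= s)%N ->
     {ae P, forall w, sup_tv nu t l s w @[t --> \oo] --> 0%E}) /\
  (positive_chain mu q ->
   exists alpha : R, (0 < alpha < 1) /\
     forall s : nat, (1 <= s)%N ->
       exists C : Omega -> R,
         generated_measurable (generators [set k | (s <= k)%N] (Xs Z)) C /\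
         forall t l : nat, (1 <= l <= s)%N -> (s <= t)%N ->
           {ae P, forall w, (sup_tv nu t l s w <= (C w * alpha ^+ (t - s))%:E)%E}).
Proof.
have r1 : (1 < r)%N by case: A1.
case: r r1 E A1 A2 => // r' _ E' A1' A2'.
have [e [delta [D [e01 d0 mD] [psiD DB]]]] := accessible_blocks q_density Pz_law A1' A2'.
have [e0 e1] := andP e01.
have rho01 : 0 < 1 - e ^+ 2 < 1.
  by rewrite subr_gt0 exprn_ilt1 ?(ltW e0)//= ltrBlDr ltrDl exprn_gt0.
have [theta theta01 rho_theta] := root_lower_bound r'.+1 rho01.
have mG : measurable (good_block q E' Yp e).
  by apply: measurable_window_event; exact: (measurable_bounded_part q_density A1').
have ioG := harris_io q_density Pz_law Z_harris mD mG psiD d0 DB.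
split.
  move=> l s l1 s1.
  exact: (forgetting q_density Pz_law Z_markov A1' nu_law e01 theta01 rho_theta ioG).
move=> [pi pi_inv].
have psiT : (0 < psi setT)%E by apply: (lt_le_trans psiD); exact: measure_mono.
have [M linG] := linear_growth q_density Pz_law pi_inv psiT Z_harris mG ioG.
have [alpha alpha01 theta_alpha] := root_lower_bound M theta01.
exists alpha; split => // s s1.
exact: (exponential_forgetting q_density Pz_law Z_markov A1' nu_law e01 theta01 rho_theta linG).
Qed.
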